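(* Let $\Omega=\{(\tau(A),\rho(A)): A\in\mathcal{C}\}$ be the exact $\tau$-$\rho$ region and let $\Omega_\Phi=\{(x,y)\in[-1,1]^2:\ \Phi(x)\le y\le -\Phi(-x)\}$. Then $\Omega\subseteq\Omega_\Phi$.
   Context: $\mathcal{C}$ denotes the family of all two-dimensional copulas. For $A\in\mathcal{C}$, $\mu_A$ is the corresponding doubly stochastic measure on $[0,1]^2$, determined by $\mu_A([0,x]\times[0,y])=A(x,y)$. Kendall's $\tau$ and Spearman's $\rho$ of $A$ are $$\tau(A)=4\int_{[0,1]^2}A(x,y)\,d\mu_A(x,y)-1,\qquad \rho(A)=12\int_{[0,1]^2}xy\,d\mu_A(x,y)-3.$$ Equivalently, $\Omega$ is the set of all pairs $(\tau(X,Y),\rho(X,Y))$ with $X,Y$ random variables (on a common probability space) having continuous distribution functions, since $\tau(X,Y)$ and $\rho(X,Y)$ depend only on the copula of $(X,Y)$. For an integer $n\ge2$ and $x\in[-1+\frac2n,1]$ let $$\Phi_n(x)=-1-\frac{4}{n^2}+\frac3n+\frac{3x}{n}-\frac{n-2}{\sqrt2\,n^2\sqrt{n-1}}\,(n-2+nx)^{3/2}.$$ The function $\Phi:[-1,1]\to[-1,1]$ is defined by $\Phi(-1)=-1$ and $\Phi(x)=\Phi_n(x)$ if $x\in\left[\frac{2-n}{n},\frac{2-(n-1)}{n-1}\right]$ for some integer $n\ge2$ (the definitions agree at common endpoints). *)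

(* Defs.v *)
From HB Require Import structures.
From mathcomp Require Import all_boot all_order all_algebra.
From mathcomp Require Import all_classical all_reals all_analysis.

Set Implicit Arguments.
Unset Strict Implicit.
Unset Printing Implicit Defensive.

Import Order.TTheory GRing.Theory Num.Theory.

Local Open Scope classical_set_scope.
Local Open Scope ring_scope.

(* A copula is represented by a total function R -> R -> R; only its values on
   the unit square are constrained, and only those matter below. *)
Record is_copula (R : realType) (A : R -> R -> R) : Prop := IsCopula {
  copula_x0 : forall x, 0 <= x <= 1 -> A x 0 = 0 ;
  copula_0y : forall y, 0 <= y <= 1 -> A 0 y = 0 ;
  copula_x1 : forall x, 0 <= x <= 1 -> A x 1 = x ;
  copula_1y : forall y, 0 <= y <= 1 -> A 1 y = y ;
  copula_2increasing : forall x1 x2 y1 y2,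
    0 <= x1 -> x1 <= x2 -> x2 <= 1 -> 0 <= y1 -> y1 <= y2 -> y2 <= 1 ->
    0 <= A x2 y2 - A x1 y2 - A x2 y1 + A x1 y1
}.

Definition unit_square (R : realType) : set (R * R) :=
  `[0, 1]%classic `*` `[0, 1]%classic.

(* As A 1 1 = 1, such a measure on the plane is carried by the unit square; the
   margins of a copula A make it doubly stochastic. *)
Definition induces (R : realType) (mu : probability (R * R)%type R)
    (A : R -> R -> R) : Prop :=
  forall x y : R, 0 <= x <= 1 -> 0 <= y <= 1 ->
    mu (`[0, x]%classic `*` `[0, y]%classic) = (A x y)%:E.

(* For a copula A, there is exactly one measure satisfying [induces]. *)
Definition copula_measure (R : realType) (A : R -> R -> R) :
    probability (R * R)%type R :=
  get [set mu | induces mu A].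

Definition kendall_tau (R : realType) (A : R -> R -> R) : R :=
  4 * (\int[copula_measure A]_(p in @unit_square R) A p.1 p.2) - 1.

Definition spearman_rho (R : realType) (A : R -> R -> R) : R :=
  12 * (\int[copula_measure A]_(p in @unit_square R) (p.1 * p.2)) - 3.

Definition Omega (R : realType) : set (R * R) :=
  [set (kendall_tau A, spearman_rho A) | A in [set A | @is_copula R A]].

Definition Phi_n (R : realType) (n : nat) (x : R) : R :=
  - 1 - 4 / n%:R ^+ 2 + 3 / n%:R + 3 * x / n%:R
  - (n%:R - 2) / (Num.sqrt 2 * n%:R ^+ 2 * Num.sqrt (n%:R - 1))
    * (n%:R - 2 + n%:R * x) `^ (3 / 2).

Definition Phi_piece (R : realType) (x : R) : set nat :=
  [set n | (2 <= n)%N /\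
     (2 - n%:R) / n%:R <= x <= (2 - (n%:R - 1)) / (n%:R - 1)].

(* The intervals of [Phi_piece] cover ]-1, 1] and overlap only at endpoints,
   where the two formulas agree, so the choice made by [get] is immaterial. *)
Definition Phi (R : realType) (x : R) : R :=
  if x == - 1 then - 1 else Phi_n (get (Phi_piece x)) x.

Definition Omega_Phi (R : realType) : set (R * R) :=
  [set p | [/\ -1 <= p.1 <= 1, -1 <= p.2 <= 1 &
               Phi p.1 <= p.2 <= - Phi (- p.1)]].

(* Main.v *)
(* Put p = (1 + tau) / 2 and f = (1 + rho) / 2.  Cut the square into N x N cells,
   ordered by strict dominance in both coordinates, and give every cell its
   A-volume as weight.  Up to O(1/N), p is the weight of the ordered pairs of
   equal or comparable cells, and f is at least the weight of the triples in which
   a majority of the pairs is comparable.  The lower bound thus follows from a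
   bound for weighted finite posets: minimise the cubic form of the majority
   triples when the quadratic form of the comparable pairs is at least p.  At a
   minimiser of smallest support, two comparable elements have distinct degrees,
   since otherwise one of them could be emptied by a concave move.  The first and
   second order conditions then exclude chains of length three, induced matchings
   and twins; what is left has a leaf on either side, whose neighbours would each
   need a degree larger than the other's.  Hence the minimiser is an antichain, on
   which one minimises a sum of cubes for a given sum of squares: k equal weights
   and one smaller weight, the parametrisation of the graph of Phi.  The upper
   bound is the lower bound for the reflected weights.

   That A is induced by a measure is seen by bisecting the square and the interval
   [0, 1[ in parallel, the latter according to the A-volumes; matching the halves
   gives a map of the interval to the square, and the image of Lebesgue measure
   under it induces A. *)
From HB Require Import structures.
Require Import Defs.
From mathcomp Require Import all_boot all_order all_algebra.
From mathcomp Require Import all_classical all_reals all_analysis.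
From mathcomp Require Import measurable_realfun.
From mathcomp Require Import ring lra zify.

Set Implicit Arguments.
Unset Strict Implicit.
Unset Printing Implicit Defensive.

Import Order.TTheory GRing.Theory Num.Theory.
Import numFieldNormedType.Exports.

Local Open Scope classical_set_scope.
Local Open Scope ring_scope.

(** * The majority form of a graph *)

(** Why majorities bound $\rho$: with uniform margins, [x * y] is the probability that one
    independent point lies to the left of [(x, y)] and another one below it. Summed over all roles
    of three points, these quadrant events number two if a majority of the pairs is concordant and
    one otherwise, which gives $6\int xy - 1$. The second order condition holds only for directions
    orthogonal to both constraint gradients, the constant vector and the degree vector. On three
    points of distinct degrees such a direction has differences of degrees as coefficients, so every
    exclusion is a sign analysis of these differences. The negative terms carry the weight of the
    symmetric difference of two closed neighbourhoods; distinct degrees of comparable elements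
    guarantee that this weight is positive, which is why equal degrees are merged before anything
    else. Mass and edges are constrained by inequalities, [\sum u <= 1] and [p <= edges u]. This
    lets a zero weight be deleted and a surplus be scaled away, and gives the multiplier [c] of the
    mass a sign, from which every degree is at most [2 * h]. *)

Section PointCombination.
Variables (R : realFieldType) (I : finType).

Definition pt4 (a b c e : R) (i j k l x : I) : R :=
  a * (x == i)%:R + b * (x == j)%:R + c * (x == k)%:R + e * (x == l)%:R.

Lemma sum_pt (G : I -> R) i : \sum_x (x == i)%:R * G x = G i.
Proof.
rewrite (bigD1 i) //= eqxx mul1r big1 ?addr0 // => x /negbTE ->.
by rewrite mul0r.
Qed.

Lemma sum_pt4 (G : I -> R) a b c e i j k l :
  \sum_x pt4 a b c e i j k l x * G x = a * G i + b * G j + c * G k + e * G l.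
Proof.
rewrite /pt4 -(sum_pt G i) -(sum_pt G j) -(sum_pt G k) -(sum_pt G l).
rewrite !mulr_sumr -!big_split /=; apply: eq_bigr => x _; ring.
Qed.

Lemma sum_pt4_1 a b c e i j k l : \sum_x pt4 a b c e i j k l x = a + b + c + e.
Proof.
have := sum_pt4 (fun=> 1) a b c e i j k l; rewrite !mulr1 => <-.
by apply: eq_bigr => x _; rewrite mulr1.
Qed.

End PointCombination.

Section Majority.
Variables (R : realFieldType) (I : finType) (adj : rel I).
Implicit Types (u v w : I -> R) (i j k : I).

Definition amx i j : R := (adj i j)%:R.
(** The majority polynomial of three bits. For reflexive [adj] a repeated index counts as adjacent
    to itself, so [maj i i k] is [amx i k]. *)
Definition maj i j k : R :=
  amx i j * amx j k + amx j k * amx i k + amx i j * amx i k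
  - 2 * (amx i j * amx j k * amx i k).

Definition edges u : R := \sum_i \sum_j amx i j * u i * u j.
Definition wdeg u i : R := \sum_j amx i j * u j.
Definition wcod u i j : R := \sum_k u k * amx i k * amx j k.
Definition cubic u v w : R :=
  \sum_i \sum_j \sum_k maj i j k * u i * v j * w k.
(** For symmetric [adj], [6 * majw u] is the Hessian and [3 * majd u] the gradient of the cubic form
    at [u], as [2 * wdeg u] is the gradient of [edges]. *)
Definition majw u i j : R := \sum_k maj i j k * u k.
Definition majd u i : R := \sum_j majw u i j * u j.

Hypothesis adjC : forall i j, adj i j = adj j i.
Hypothesis adjR : forall i, adj i i.

Lemma amxC i j : amx i j = amx j i. Proof. by rewrite /amx adjC. Qed.

Lemma majC12 i j k : maj i j k = maj j i k.
Proof. rewrite /maj (amxC j i); ring. Qed.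
Lemma majC23 i j k : maj i j k = maj i k j.
Proof. rewrite /maj (amxC k j); ring. Qed.

Lemma cubicC12 u v w : cubic u v w = cubic v u w.
Proof.
rewrite /cubic exchange_big; apply: eq_bigr => j _; apply: eq_bigr => i _.
apply: eq_bigr => k _; rewrite majC12; ring.
Qed.
Lemma cubicC23 u v w : cubic u v w = cubic u w v.
Proof.
rewrite /cubic; apply: eq_bigr => i _; rewrite exchange_big.
apply: eq_bigr => j _; apply: eq_bigr => k _; rewrite majC23; ring.
Qed.

Lemma cubicD u u' v w t :
  cubic (fun x => u x + t * u' x) v w = cubic u v w + t * cubic u' v w.
Proof.
rewrite /cubic mulr_sumr -big_split; apply: eq_bigr => i _ /=.
rewrite mulr_sumr -big_split; apply: eq_bigr => j _ /=.
rewrite mulr_sumr -big_split; apply: eq_bigr => k _ /=; ring.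
Qed.

Lemma cubic_line u v t : let w x := u x + t * v x in
  cubic w w w = cubic u u u + 3 * t * cubic v u u
                + 3 * t ^+ 2 * cubic v v u + t ^+ 3 * cubic v v v.
Proof.
move=> w.
have E a b : cubic w a b = cubic u a b + t * cubic v a b by exact: cubicD.
have E2 a b : cubic a w b = cubic a u b + t * cubic a v b.
  by rewrite cubicC12 E cubicC12 (cubicC12 v).
have E3 a b : cubic a b w = cubic a b u + t * cubic a b v.
  by rewrite cubicC23 E2 cubicC23 (cubicC23 a v).
have H1 : cubic u u v = cubic v u u by rewrite cubicC23 cubicC12.
have H2 : cubic u v u = cubic v u u by rewrite cubicC12.
have H3 : cubic u v v = cubic v v u by rewrite cubicC12 cubicC23.
have H4 : cubic v u v = cubic v v u by rewrite cubicC23.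
rewrite E !E2 !E3 H1 H2 H3 H4; ring.
Qed.

Lemma edges_line u v t :
  edges (fun x => u x + t * v x)
  = edges u + 2 * t * (\sum_i wdeg u i * v i) + t ^+ 2 * edges v.
Proof.
have -> : \sum_i wdeg u i * v i = \sum_i \sum_j amx i j * u i * v j.
  rewrite exchange_big /=; apply: eq_bigr => i _; rewrite /wdeg mulr_suml.
  by apply: eq_bigr => j _; rewrite amxC.
have E : \sum_i \sum_j amx i j * u i * v j = \sum_i \sum_j amx i j * v i * u j.
  rewrite exchange_big; apply: eq_bigr => i _; apply: eq_bigr => j _.
  by rewrite amxC; ring.
rewrite mulrDl mul1r mulrDl {2}E /edges !mulr_sumr -!big_split.
apply: eq_bigr => i _ /=; rewrite !mulr_sumr -!big_split.
by apply: eq_bigr => j _ /=; ring.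
Qed.

Lemma cubic_majd u v : cubic v u u = \sum_i majd u i * v i.
Proof.
apply: eq_bigr => i _; rewrite /majd mulr_suml; apply: eq_bigr => j _.
rewrite /majw !mulr_suml; apply: eq_bigr => k _; ring.
Qed.

Lemma cubic_majw u v w : cubic v w u = \sum_i \sum_j majw u i j * v i * w j.
Proof.
apply: eq_bigr => i _; apply: eq_bigr => j _.
rewrite /majw !mulr_suml; apply: eq_bigr => k _; ring.
Qed.

Lemma wcodC u i j : wcod u i j = wcod u j i.
Proof. by apply: eq_bigr => k _; ring. Qed.

Lemma wcod_id u i : wcod u i i = wdeg u i.
Proof.
apply: eq_bigr => k _; rewrite /amx; case: (adj i k); rewrite /=; ring.
Qed.

(** If [i] and [j] are adjacent, a third element makes a majority as soon as it is adjacent to one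
    of them: the union of the closed neighbourhoods. Otherwise it must be adjacent to both: the
    intersection. *)
Lemma majwE u i j :
  majw u i j = if adj i j then wdeg u i + wdeg u j - wcod u i j
               else wcod u i j.
Proof.
have E : majw u i j =
    amx i j * (wdeg u i + wdeg u j - 2 * wcod u i j) + wcod u i j.
  rewrite /majw /wdeg /wcod -big_split mulr_sumr -sumrN -big_split /=.
  rewrite mulr_sumr -big_split; apply: eq_bigr => k _ /=; rewrite /maj; ring.
rewrite E /amx; case: (adj i j) => /=; ring.
Qed.

Lemma majdE u i :
  majd u i = wdeg u i ^+ 2
             + 2 * \sum_j amx i j * u j * (wdeg u j - wcod u i j).
Proof.
(* Both sides weigh the walks of length two from [i], grouped by their end on the left and by their
   middle on the right. *)
have E : \sum_j wcod u i j * u j = \sum_j amx i j * u j * wdeg u j.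
  rewrite /wcod /wdeg.
  under eq_bigr do rewrite mulr_suml.
  rewrite exchange_big /=; apply: eq_bigr => k _.
  rewrite mulr_sumr; apply: eq_bigr => j _; rewrite (amxC j k); ring.
have -> : majd u i = \sum_j (amx i j * (wdeg u i + wdeg u j - 2 * wcod u i j)) * u j
     + \sum_j wcod u i j * u j.
  rewrite -big_split; apply: eq_bigr => j _ /=.
  rewrite majwE /amx; case: (adj i j) => /=; ring.
have -> : wdeg u i ^+ 2 = \sum_j amx i j * u j * wdeg u i.
  by rewrite expr2 {1}/wdeg mulr_suml.
rewrite E mulr_sumr -!big_split /=.
by apply: eq_bigr => j _; ring.
Qed.

Lemma cubic_pt4 u a b c e i j k l :
  let v := pt4 a b c e i j k l in
  cubic v v u = a * (a * majw u i i + b * majw u i j + c * majw u i k + e * majw u i l)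
    + b * (a * majw u j i + b * majw u j j + c * majw u j k + e * majw u j l)
    + c * (a * majw u k i + b * majw u k j + c * majw u k k + e * majw u k l)
    + e * (a * majw u l i + b * majw u l j + c * majw u l k + e * majw u l l).
Proof.
move=> v; rewrite cubic_majw.
have E x : \sum_y majw u x y * v x * v y =
    v x * (a * majw u x i + b * majw u x j + c * majw u x k + e * majw u x l).
  rewrite -(sum_pt4 (majw u x)) mulr_sumr; apply: eq_bigr => y _; rewrite /v; ring.
under eq_bigr do rewrite E.
by rewrite (sum_pt4 (fun x => a * majw u x i + b * majw u x j + c * majw u x k
  + e * majw u x l)).
Qed.

Lemma edges_pt4 a b c e i j k l :
  let v := pt4 a b c e i j k l in
  edges v = a * (a * amx i i + b * amx i j + c * amx i k + e * amx i l)
    + b * (a * amx j i + b * amx j j + c * amx j k + e * amx j l)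
    + c * (a * amx k i + b * amx k j + c * amx k k + e * amx k l)
    + e * (a * amx l i + b * amx l j + c * amx l k + e * amx l l).
Proof.
move=> v; rewrite /edges.
have E x : \sum_y amx x y * v x * v y =
    v x * (a * amx x i + b * amx x j + c * amx x k + e * amx x l).
  rewrite -(sum_pt4 (amx x)) mulr_sumr; apply: eq_bigr => y _; rewrite /v; ring.
under eq_bigr do rewrite E.
by rewrite (sum_pt4 (fun x => a * amx x i + b * amx x j + c * amx x k + e * amx x l)).
Qed.

End Majority.

(** * Critical points of the majority form of a poset *)

Section CriticalPoint.
Variables (R : realFieldType) (I : finType) (lt : rel I).
Hypothesis lt_irr : irreflexive lt.
Hypothesis lt_trans : transitive lt.

Definition cmp (i j : I) := [|| i == j, lt i j | lt j i].

Lemma cmpC i j : cmp i j = cmp j i.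
Proof. by rewrite /cmp eq_sym [lt i j || _]orbC. Qed.
Lemma cmpR i : cmp i i. Proof. by rewrite /cmp eqxx. Qed.

Variables (u : I -> R) (h c : R).
Local Notation m := (amx R cmp).
Local Notation d := (wdeg cmp u).
Local Notation W := (wcod cmp u).

Hypothesis u_gt0 : forall i, 0 < u i.
Hypothesis c_ge0 : 0 <= c.
(** [3 * h] and [3 * c] are the Lagrange multipliers of the edge and the mass constraint; [hess_ge0]
    is the second order condition for the same Lagrangian, divided by 3. *)
Hypothesis grad_eq : forall i, majd cmp u i = 2 * h * d i - c.
Hypothesis hess_ge0 : forall v : I -> R, \sum_i v i = 0 ->
  \sum_i d i * v i = 0 -> 0 <= cubic cmp v v u - h * edges cmp v.
Hypothesis d_neq : forall i j, i != j -> cmp i j -> d i != d j.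

(** The matrix [majw cmp u i j - h * m i j] of the second order form, with [majwE] expanded. *)
Let Bf i j := (if cmp i j then d i + d j - W i j - h else W i j).

Lemma hess_pt4 (a b e f : R) (i j k l : I) :
  a + b + e + f = 0 -> a * d i + b * d j + e * d k + f * d l = 0 ->
  0 <= a * (a * Bf i i + b * Bf i j + e * Bf i k + f * Bf i l)
    + b * (a * Bf j i + b * Bf j j + e * Bf j k + f * Bf j l)
    + e * (a * Bf k i + b * Bf k j + e * Bf k k + f * Bf k l)
    + f * (a * Bf l i + b * Bf l j + e * Bf l k + f * Bf l l).
Proof.
move=> s0 d0; have := @hess_ge0 (pt4 a b e f i j k l).
rewrite sum_pt4_1 s0.
have -> : \sum_x d x * pt4 a b e f i j k l x = 0.
  by under eq_bigr do rewrite mulrC; rewrite sum_pt4.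
move=> /(_ erefl erefl).
have BE x y : Bf x y = majw cmp u x y - h * m x y.
  rewrite majwE /Bf /amx.
  by case: ifP => _ /=; ring.
by rewrite cubic_pt4 edges_pt4 !BE => /le_trans; apply; rewrite le_eqVlt;
  apply/orP; left; apply/eqP; ring.
Qed.

Lemma m_01 i j : m i j = 0 \/ m i j = 1.
Proof. by rewrite /amx; case: cmp; [right|left]. Qed.

Lemma wcod_ge0 i j : 0 <= W i j.
Proof.
apply: sumr_ge0 => k _; have := u_gt0 k.
by case: (m_01 i k) => ->; case: (m_01 j k) => ->; lra.
Qed.

Lemma wcod_le i j : W i j <= d i.
Proof.
apply: ler_sum => k _; have := u_gt0 k.
by case: (m_01 i k) => ->; case: (m_01 j k) => ->; lra.
Qed.

(** Both sets on the left lie in the closed neighbourhood of [j], and what they share is adjacent to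
    both [i] and [k]. *)
Lemma wcod_triangle i j k : W i j + W j k <= d j + W i k.
Proof.
rewrite -!big_split; apply: ler_sum => l _ /=; have := u_gt0 l.
by case: (m_01 i l) => ->; case: (m_01 j l) => ->; case: (m_01 k l) => ->; lra.
Qed.

(** This is the weight of the symmetric difference of the closed neighbourhoods; if it vanished, the
    degrees would agree. *)
Lemma wdist_gt0 i j : i != j -> cmp i j -> 0 < d i + d j - 2 * W i j.
Proof.
move=> ij aij; have := d_neq ij aij; have := wcod_le i j.
have := wcod_le j i; rewrite wcodC.
by rewrite neq_lt => ? ? /orP[]; lra.
Qed.

Lemma BfC x y : Bf x y = Bf y x.
Proof. by rewrite /Bf cmpC wcodC [d x + d y]addrC. Qed.

(** The coefficients [d j - d k], [d k - d i], [d i - d j] at [i], [j], [k] satisfy both linear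
    constraints. The form is regrouped around [j] to bring out whether [d j] lies between the other
    two degrees. *)
Lemma hess_three i j k :
  0 <= (d j - d k) ^+ 2 * (Bf i i + Bf j j - 2 * Bf i j)
     + (d j - d i) ^+ 2 * (Bf k k + Bf j j - 2 * Bf j k)
     - 2 * ((d j - d i) * (d j - d k)) * (Bf i k - Bf i j - Bf j k + Bf j j).
Proof.
set s := d j - d i; set t := d j - d k.
have := @hess_pt4 t (s - t) (- s) 0 i j k k.
have -> : t + (s - t) + - s + 0 = 0 by ring.
have -> : t * d i + (s - t) * d j + - s * d k + 0 * d k = 0 by rewrite /s /t; ring.
move=> /(_ erefl erefl) /le_trans; apply.
rewrite (BfC j i) (BfC k i) (BfC k j).
rewrite le_eqVlt; apply/orP; left; apply/eqP; ring.
Qed.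

Lemma Bdiag i : Bf i i = d i - h.
Proof. rewrite /Bf cmpR wcod_id; ring. Qed.

(** In a clique the first two terms of [hess_three] are minus a square times a symmetric difference,
    and the last bracket is non-positive by [wcod_triangle]. If [d j] lay strictly between, the
    whole form would be negative. *)
Lemma clique3_median i j k : i != j -> cmp i j -> j != k -> cmp j k -> cmp i k ->
  (d j - d i) * (d j - d k) < 0 -> False.
Proof.
move=> ij aij jk ajk aik st.
have D1 := wdist_gt0 ij aij; have D2 := wdist_gt0 jk ajk.
have tr := wcod_triangle i j k.
have := hess_three i j k; rewrite !Bdiag /Bf aij ajk aik.
have s0 : 0 < (d j - d k) ^+ 2.
  by rewrite exprn_even_gt0 //=; apply/eqP => E; rewrite E mulr0 ltxx in st.
have s1 : 0 <= (d j - d i) ^+ 2 by exact: sqr_ge0.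
move: st s0 s1 D1 D2 tr.
move: (d j - d i) (d j - d k) => s t st t0 s0 D1 D2 tr.
have := mulr_gt0 t0 D1; have := mulr_ge0 s0 (ltW D2).
have : 0 <= - (s * t) * (2 * (d j + W i k - W i j - W j k)) by apply: mulr_ge0; lra.
lra.
Qed.

(** The three degrees are distinct, so one of the elements has the middle one. *)
Lemma no_chain3 i j k : lt i j -> lt j k -> False.
Proof.
move=> ij jk; have ik := lt_trans ij jk.
have ne x y : lt x y -> x != y.
  by move=> xy; apply: contraTneq xy => ->; rewrite lt_irr.
have aij : cmp i j by rewrite /cmp ij orbT.
have ajk : cmp j k by rewrite /cmp jk orbT.
have aik : cmp i k by rewrite /cmp ik orbT.
have [[nij njk] nik] := (ne _ _ ij, ne _ _ jk, ne _ _ ik).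
have neg (a b : R) : a < 0 -> 0 < b -> a * b < 0 by move=> *; rewrite nmulr_rlt0.
have neg' (a b : R) : 0 < a -> b < 0 -> a * b < 0 by move=> *; rewrite pmulr_rlt0.
have := d_neq nij aij; have := d_neq njk ajk; have := d_neq nik aik.
have C1 := clique3_median nij aij njk ajk aik.
have aji : cmp j i by rewrite cmpC.
have akj : cmp k j by rewrite cmpC.
have aki : cmp k i by rewrite cmpC.
have C2 : (d i - d j) * (d i - d k) < 0 -> False.
  by apply: (@clique3_median j i k) => //; rewrite eq_sym.
have C3 : (d k - d i) * (d k - d j) < 0 -> False.
  by apply: (@clique3_median i k j) => //; rewrite eq_sym.
rewrite !neq_lt => /orP[] H1 /orP[] H2 /orP[] H3.
- by apply: C1; apply: neg'; lra.
- by apply: C2; apply: neg'; lra.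
- by apply: C3; apply: neg'; lra.
- by lra.
- by lra.
- by apply: C3; apply: neg; lra.
- by apply: C2; apply: neg; lra.
- by apply: C1; apply: neg; lra.
Qed.

(** As for a clique, except that the cross term now has [W i k] where the clique had a union; the
    numerical hypothesis supplies the sign that came from [wcod_triangle] there. *)
Lemma path_extreme i j k : i != j -> cmp i j -> j != k -> cmp j k -> ~~ cmp i k ->
  0 < d i + d j + d k - W i k - W i j - W j k - h ->
  0 < (d j - d i) * (d j - d k).
Proof.
move=> ij aij jk ajk /negbTE aik th.
have D1 := wdist_gt0 ij aij; have D2 := wdist_gt0 jk ajk.
have := hess_three i j k; rewrite !Bdiag /Bf aij ajk aik.
have s0 : 0 < (d j - d k) ^+ 2.
  by rewrite exprn_even_gt0 //= subr_eq0 d_neq.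
have s1 : 0 <= (d j - d i) ^+ 2 by exact: sqr_ge0.
move: s0 s1 D1 D2 th.
move: (d j - d i) (d j - d k) => s t t0 s0 D1 D2 th H.
rewrite ltNge; apply/negP => st.
have := mulr_gt0 t0 D1; have := mulr_ge0 s0 (ltW D2).
have : 0 <= - (s * t) * (2 * (d i + d j + d k - W i k - W i j - W j k - h)).
  by apply: mulr_ge0; lra.
lra.
Qed.

Lemma wcod_le2 i k p q : p != q -> cmp i p -> cmp i q -> ~~ cmp k p -> ~~ cmp k q ->
  W i k <= d i - u p - u q.
Proof.
move=> pq ip iq /negbTE kp /negbTE kq.
have -> : d i - u p - u q = \sum_j (m i j * u j - (j == p)%:R * u j - (j == q)%:R * u j).
  by rewrite !big_split /= !sumrN !sum_pt.
apply: ler_sum => j _; have := u_gt0 j.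
have [->|jp] := eqVneq j p.
  by rewrite (negbTE pq) /amx ip kp /=; lra.
have [E|jq] := eqVneq j q; first by rewrite E /amx iq kq /=; lra.
by case: (m_01 i j) => ->; case: (m_01 k j) => -> /=; lra.
Qed.

(** A triangle of comparable elements is a chain of length three, so an edge has no common
    neighbours besides its ends. *)
Lemma wcod_edge i j : i != j -> cmp i j -> W i j = u i + u j.
Proof.
move=> ij aij; rewrite -(sum_pt u i) -(sum_pt u j) -big_split; apply: eq_bigr => k _ /=.
have [->|ki] := eqVneq k i.
  by rewrite (negbTE ij) /amx cmpR cmpC aij /=; ring.
have [->|kj] := eqVneq k j; first by rewrite /amx cmpR aij /=; ring.
suff : ~~ (cmp i k && cmp j k).
  by rewrite /amx; case: (cmp i k); case: (cmp j k) => //= _; ring.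
apply/negP; rewrite /cmp ![_ == k]eq_sym (negbTE ki) (negbTE kj) /=.
move: aij; rewrite /cmp (negbTE ij) /=.
by move=> /orP[] a /andP[/orP[] b /orP[] e];
  (exact: no_chain3 a b) || (exact: no_chain3 a e) || (exact: no_chain3 b a)
  || (exact: no_chain3 b e) || (exact: no_chain3 e a) || (exact: no_chain3 e b).
Qed.

Lemma wcod_far x z k l : lt x z -> lt k l -> ~~ cmp x l -> W x l = 0.
Proof.
move=> xz kl nxl; apply: big1 => j _.
suff : ~~ (cmp x j && cmp l j).
  by rewrite /amx; case: (cmp x j); case: (cmp l j) => //= _; ring.
apply/negP => /andP[]; rewrite {1 2}/cmp => /or3P[/eqP<-|a|a].
- by rewrite -/(cmp l x) cmpC (negbTE nxl).
- move=> /or3P[/eqP E|b|b]; last exact: no_chain3 a b.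
    by rewrite E /cmp a orbT in nxl.
  exact: no_chain3 kl b.
- by move=> _; exact: no_chain3 a xz.
Qed.

(** Weight is moved along each edge in proportion to the degree gap of the other edge, which
    preserves mass and, to first order, edges. The form on this direction is minus a sum of three
    non-negative terms, so all three vanish; this makes the gaps [s] and [t] both opposite and
    equal. *)
Lemma no_matching2 x z k l : lt x z -> lt k l -> ~~ cmp x k -> ~~ cmp x l ->
  ~~ cmp z k -> ~~ cmp z l -> False.
Proof.
move=> xz kl xk xl zk zl.
have ne p q : lt p q -> p != q.
  by move=> pq; apply: contraTneq pq => ->; rewrite lt_irr.
have axz : cmp x z by rewrite /cmp xz orbT.
have akl : cmp k l by rewrite /cmp kl orbT.
have [nxz nkl] := (ne _ _ xz, ne _ _ kl).
have D1 := wdist_gt0 nxz axz; have D2 := wdist_gt0 nkl akl.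
have Wxl : W x l = 0 by exact: wcod_far xz kl xl.
have Wzk : W z k = 0 by rewrite wcodC (wcod_far kl xz) // cmpC.
rewrite !wcod_edge // in D1 D2.
have b1 : W x k <= d x - u x - u z.
  by apply: wcod_le2 => //; rewrite ?cmpR // cmpC.
have b2 : W z l <= d z - u z - u x.
  by apply: wcod_le2; rewrite 1?eq_sym ?cmpR //; rewrite cmpC.
have b3 : W x k <= d k - u k - u l.
  by rewrite wcodC; apply: wcod_le2 => //; rewrite ?cmpR // cmpC.
have b4 : W z l <= d l - u l - u k.
  by rewrite wcodC; apply: wcod_le2; rewrite 1?eq_sym ?cmpR //; rewrite cmpC.
have n1 : d z - d x != 0 by rewrite subr_eq0 eq_sym d_neq.
have n2 : d l - d k != 0 by rewrite subr_eq0 eq_sym d_neq.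
have := @hess_pt4 (d l - d k) (- (d l - d k)) (- (d z - d x)) (d z - d x) z x l k.
have -> : d l - d k + - (d l - d k) + - (d z - d x) + (d z - d x) = 0 by ring.
have -> : (d l - d k) * d z + - (d l - d k) * d x + - (d z - d x) * d l
  + (d z - d x) * d k = 0 by ring.
move=> /(_ erefl erefl).
have Bzx : Bf z x = d z + d x - (u x + u z) - h.
  by rewrite /Bf cmpC axz wcodC wcod_edge.
have Blk : Bf l k = d l + d k - (u k + u l) - h.
  by rewrite /Bf cmpC akl wcodC wcod_edge.
have Bzk : Bf z k = 0 by rewrite /Bf (negbTE zk).
have Bxl : Bf x l = 0 by rewrite /Bf (negbTE xl).
have Bzl : Bf z l = W z l by rewrite /Bf (negbTE zl).
have Bxk : Bf x k = W x k by rewrite /Bf (negbTE xk).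
rewrite (BfC x z) (BfC l z) (BfC k z) (BfC l x) (BfC k x) (BfC k l).
rewrite !Bdiag Bzx Blk Bzk Bxl Bzl Bxk => H.
have := wcod_ge0 x k; have := wcod_ge0 z l.
move: (W x k) (W z l) b1 b2 b3 b4 H => Y X b1 b2 b3 b4 H X0 Y0.
set D := d x + d z - 2 * (u x + u z) in D1.
set D' := d k + d l - 2 * (u k + u l) in D2.
set s := d z - d x in n1 H *; set t := d l - d k in n2 H *.
have {}H : t ^+ 2 * D + s ^+ 2 * D' + 2 * (s * t) * (X + Y) <= 0.
  by rewrite /D /D' /s /t in H *; lra.
have s2 : 0 < s ^+ 2 by rewrite exprn_even_gt0.
have t2 : 0 < t ^+ 2 by rewrite exprn_even_gt0.
have XD : 0 <= D - (X + Y) by rewrite /D; lra.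
have XD' : 0 <= D' - (X + Y) by rewrite /D'; lra.
have E : t ^+ 2 * (D - (X + Y)) + s ^+ 2 * (D' - (X + Y)) + (s + t) ^+ 2 * (X + Y) <= 0.
  by move: H; lra.
have p1 := mulr_ge0 (ltW t2) XD; have p2 := mulr_ge0 (ltW s2) XD'.
have p3 : 0 <= (s + t) ^+ 2 * (X + Y).
  by apply: mulr_ge0; [exact: sqr_ge0 | lra].
have /eqP : t ^+ 2 * (D - (X + Y)) = 0 by lra.
rewrite mulf_eq0 (gt_eqF t2) /= => /eqP e1.
have /eqP : s ^+ 2 * (D' - (X + Y)) = 0 by lra.
rewrite mulf_eq0 (gt_eqF s2) /= => /eqP e2.
have /eqP : (s + t) ^+ 2 * (X + Y) = 0 by lra.
have -> : X + Y = D by lra.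
rewrite mulf_eq0 (gt_eqF D1) orbF sqrf_eq0 => /eqP e3.
(* By [e1] and [e2] the bounds [b1] to [b4] are equalities, and [Y - X] is then the degree gap of
   either edge. *)
have : s = t by rewrite /s /t /D /D' in e1 e2 *; lra.
by move=> st; move/eqP: n1; apply; lra.
Qed.

(** * Open neighbourhoods, twins and leaves *)

Definition nb (i j : I) : R := m i j - (j == i)%:R.

Lemma nb_ge0 i j : 0 <= nb i j.
Proof.
rewrite /nb; have [->|_] := eqVneq j i; first by rewrite /amx cmpR subrr.
by rewrite subr0 /amx ler0n.
Qed.

Lemma nbE i j : nb i j = ((j != i) && cmp i j)%:R.
Proof.
rewrite /nb /amx; have [->|_] := eqVneq j i; first by rewrite cmpR subrr.
by rewrite subr0.
Qed.

Lemma wdeg_nb i : d i = u i + \sum_j nb i j * u j.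
Proof.
under eq_bigr do rewrite /nb mulrBl.
rewrite big_split /= sumrN sum_pt; rewrite /wdeg; ring.
Qed.

Lemma majd_nb i : majd cmp u i =
  d i ^+ 2 + 2 * \sum_j nb i j * u j * (d j - u j - u i).
Proof.
rewrite majdE; last exact: cmpC.
congr (_ + 2 * _); apply: eq_bigr => j _; rewrite nbE.
have [->|ji] := eqVneq j i; first by rewrite wcod_id subrr mulr0 /=; ring.
rewrite /amx /=; case aij: (cmp i j); last by rewrite !mul0r.
by rewrite wcod_edge 1?eq_sym //; ring.
Qed.

(** By [majdE] the gradient [2 * h * d i - c] is at least [d i ^+ 2], and [c] is non-negative. *)
Lemma wdeg_le2h i : d i <= 2 * h.
Proof.
have d0 : 0 < d i.
  by rewrite wdeg_nb ltr_pwDl // sumr_ge0 // => j _; rewrite mulr_ge0 ?nb_ge0 // ltW.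
have : d i ^+ 2 <= 2 * h * d i - c.
  rewrite -grad_eq majdE; last exact: cmpC.
  rewrite lerDl mulr_ge0 // sumr_ge0 // => j _; have := u_gt0 j.
  have := wcod_le j i; rewrite wcodC => ? ?.
  by rewrite mulr_ge0 ?subr_ge0 // mulr_ge0 ?ler0n // ltW.
by move=> H; rewrite -(ler_pM2r d0) -expr2 (le_trans H) // gerBl.
Qed.

(** Stationarity at the twins leaves two cases: [u x + u x' = 2 * h], or equal weights. In the
    second case the degrees agree too, so shifting weight between the twins is an admissible
    direction, and the second order condition gives [2 * h <= u x + u x']. Either way the common
    neighbour [z] has a degree above [2 * h]. *)
Lemma no_open_twins x x' z : x != x' -> ~~ cmp x x' -> nb x =1 nb x' ->
  cmp x z -> z != x -> z != x' -> False.
Proof.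
move=> nxx' nc E xz zx zx'.
have x'z : cmp x' z.
  by have := E z; rewrite !nbE zx zx' xz /=; case: cmp => // /eqP; rewrite oner_eq0.
have dE : d x - u x = d x' - u x'.
  by rewrite !wdeg_nb; under eq_bigr do rewrite E; ring.
have Sx y : \sum_j nb y j * u j * (d j - u j - u y)
    = \sum_j nb y j * u j * (d j - u j) - u y * (d y - u y).
  have -> : d y - u y = \sum_j nb y j * u j by rewrite wdeg_nb; ring.
  by rewrite mulr_sumr -sumrB; apply: eq_bigr => j _; ring.
have gx := grad_eq x; have gx' := grad_eq x'.
rewrite majd_nb Sx in gx; rewrite majd_nb Sx in gx'.
have CE : \sum_j nb x j * u j * (d j - u j) = \sum_j nb x' j * u j * (d j - u j).
  by under eq_bigr do rewrite E.
have F : (u x - u x') * (u x + u x' - 2 * h) = 0.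
  move: gx gx'; rewrite CE.
  have -> : d x = u x + (d x' - u x') by lra.
  by move: (\sum_j _) (d x') => C e gx gx'; lra.
have W0 : W x x' = d x - u x.
  have -> : d x - u x = \sum_j nb x j * u j by rewrite wdeg_nb; ring.
  apply: eq_bigr => j _; have := E j; rewrite !nbE /amx.
  have [->|jx] := eqVneq j x; first by rewrite [cmp x' x]cmpC (negbTE nc) /=; lra.
  have [->|jx'] := eqVneq j x'; first by rewrite (negbTE nc) /=; lra.
  by move=> /= ->; case: (cmp x' j) => /=; lra.
have ge2h : 2 * h <= u x + u x'.
  move/eqP: F; rewrite mulf_eq0 => /orP[] /eqP F; last by lra.
  have := @hess_pt4 1 (-1) 0 0 x x' x x.
  have -> : 1 + -1 + 0 + 0 = 0 :> R by ring.
  have -> : 1 * d x + -1 * d x' + 0 * d x + 0 * d x = 0 by lra.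
  move=> /(_ erefl erefl); rewrite (BfC x' x) !Bdiag /Bf (negbTE nc) W0; lra.
have := wdeg_le2h z; have := u_gt0 z.
have : u z + u x + u x' <= d z.
  have -> : u z + u x + u x' =
     \sum_j ((j == z)%:R + (j == x)%:R + (j == x')%:R) * u j.
    under eq_bigr do rewrite !mulrDl.
    by rewrite !big_split /= !sum_pt.
  apply: ler_sum => j _; have := u_gt0 j; rewrite /amx.
  have [->|jz] := eqVneq j z; first by rewrite cmpR (negbTE zx) (negbTE zx') /=; lra.
  have [->|jx] := eqVneq j x; first by rewrite cmpC xz (negbTE nxx') /=; lra.
  have [->|jx'] := eqVneq j x'; first by rewrite cmpC x'z /=; lra.
  by case: cmp => /=; lra.
lra.
Qed.

(** Subtracting stationarity at the leaf [x] from stationarity at [z] bounds [h] from above, [w]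
    having the largest open degree next to [z]. This bound yields the hypothesis of [path_extreme]
    for the path [x], [z], [w]; as [z] has a larger degree than the leaf, it also has a larger one
    than [w]. *)
Lemma leaf_deg x z w : nb x =1 (fun j => (j == z)%:R) ->
  cmp z w -> w != x -> w != z -> x != z -> ~~ cmp x w ->
  (forall k, cmp z k -> k != z -> d k - u k <= d w - u w) -> d w < d z.
Proof.
move=> leaf zw wx wz xz nxw top.
have axz : cmp x z.
  by have := leaf z; rewrite nbE eqxx; case: cmp => //; rewrite andbF => /eqP; rewrite eq_sym oner_eq0.
have dx : d x = u x + u z.
  by rewrite wdeg_nb; under eq_bigr do rewrite leaf; rewrite sum_pt.
have dz : u z + u x + u w <= d z.
  have -> : u z + u x + u w =
     \sum_j ((j == z)%:R + (j == x)%:R + (j == w)%:R) * u j.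
    under eq_bigr do rewrite !mulrDl.
    by rewrite !big_split /= !sum_pt.
  apply: ler_sum => j _; have := u_gt0 j; rewrite /amx.
  have [->|jz] := eqVneq j z.
    by rewrite cmpR [z == x]eq_sym [z == w]eq_sym (negbTE xz) (negbTE wz) /=; lra.
  have [->|jx] := eqVneq j x; first by rewrite cmpC axz eq_sym (negbTE wx) /=; lra.
  have [->|jw] := eqVneq j w; first by rewrite zw /=; lra.
  by case: cmp => /=; lra.
have Wxw : W x w = u z.
  rewrite -(sum_pt u z); apply: eq_bigr => j _; have := leaf j; rewrite nbE /amx.
  have [->|jz] := eqVneq j z; first by rewrite axz cmpC zw /=; lra.
  have [->|jx] := eqVneq j x; first by rewrite [cmp w x]cmpC (negbTE nxw) /=; lra.
  by rewrite /= => ->; ring.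
have gx := grad_eq x; have gz := grad_eq z.
rewrite majd_nb in gx; rewrite majd_nb in gz.
have Sx : \sum_j nb x j * u j * (d j - u j - u x) = u z * (d z - u z - u x).
  under eq_bigr do rewrite leaf -mulrA.
  by rewrite (sum_pt (fun j => u j * (d j - u j - u x))).
have Sz : \sum_j nb z j * u j * (d j - u j - u z)
    <= (d z - u z - u x) * (d w - u w - u z).
  have -> : d z - u z - u x = \sum_j (nb z j - (j == x)%:R) * u j.
    by under eq_bigr do rewrite mulrBl; rewrite sumrB sum_pt wdeg_nb; ring.
  rewrite mulr_suml; apply: ler_sum => j _; have := u_gt0 j.
  have [->|jx] := eqVneq j x.
    (* The term of the leaf vanishes, so its weight can be left out of the first factor of the
       bound. *)
    have -> : d x - u x - u z = 0 by rewrite dx; ring.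
    by rewrite nbE xz cmpC axz subrr mul0r mul0r mulr0.
  move=> u0; rewrite subr0 nbE; case H: (_ && _); last by rewrite !mul0r.
  move: H => /andP[jz zj]; rewrite mul1r; apply: ler_wpM2l; first exact: ltW.
  by have := top j zj jz; lra.
rewrite Sx in gx.
have m0 : 0 < d z - d x by have := u_gt0 w; lra.
(* With this bound the quantity required to be positive by [path_extreme] is at least
   [(d z - d x) / 2]. *)
have hb : 2 * h <= d x + d z - 4 * u z + 2 * (d w - u w).
  rewrite -(ler_pM2l m0).
  have -> : (d z - d x) * (2 * h) = 2 * h * d z - c - (2 * h * d x - c) by ring.
  rewrite -gx -gz.
  move: Sz; rewrite (_ : d z - u z - u x = d z - d x); last by lra.
  by move: (\sum_j _) => S HS; lra.
have := @path_extreme x z w xz axz.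
rewrite eq_sym => /(_ wz zw nxw).
rewrite Wxw !wcod_edge //; last by rewrite eq_sym.
have uw := u_gt0 w.
move=> /(_ ltac:(lra)); rewrite pmulr_rgt0 //; lra.
Qed.

Lemma nb_lower x z j : lt x z -> nb x j = (lt x j)%:R.
Proof.
move=> xz; rewrite nbE /cmp; congr (_%:R : R); congr nat_of_bool.
have [->|jx] /= := eqVneq j x; first by rewrite lt_irr.
case: (lt x j) => //=.
by apply/negP => jlx; exact: no_chain3 jlx xz.
Qed.

Lemma nb_upper x z j : lt x z -> nb z j = (lt j z)%:R.
Proof.
move=> xz; rewrite nbE /cmp; congr (_%:R : R); congr nat_of_bool.
have [->|jx] /= := eqVneq j z; first by rewrite lt_irr.
rewrite orbC; case: (lt j z) => //=.
by apply/negP => zj; exact: no_chain3 xz zj.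
Qed.

Lemma no_matching x z k l : lt x z -> lt k l -> ~~ lt x l -> ~~ lt k z -> False.
Proof.
move=> xz kl xl kz; apply: (no_matching2 xz kl).
- apply/negP => /or3P[/eqP E|a|a]; last exact: no_chain3 a xz.
    by rewrite E kl in xl.
  exact: no_chain3 a kl.
- apply/negP => /or3P[/eqP E|a|a]; last exact: no_chain3 kl a.
    by rewrite E in xz; exact: no_chain3 kl xz.
  by rewrite a in xl.
- apply/negP => /or3P[/eqP E|a|a]; last by rewrite a in kz.
    by rewrite E in xz; exact: no_chain3 xz kl.
  exact: no_chain3 xz a.
- apply/negP => /or3P[/eqP E|a|a]; last exact: no_chain3 kl a.
    by rewrite E kl in kz.
  exact: no_chain3 xz a.
Qed.

Lemma no_lower_twins x x' z : x != x' -> lt x =1 lt x' -> lt x z -> False.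
Proof.
move=> nxx' E xz; have x'z : lt x' z by rewrite -E.
apply: (@no_open_twins x x' z) => //.
- apply/negP => /or3P[/eqP e|a|a]; first by rewrite e eqxx in nxx'.
    exact: no_chain3 a x'z.
  exact: no_chain3 a xz.
- by move=> j; rewrite (nb_lower _ xz) (nb_lower _ x'z) E.
- by rewrite /cmp xz orbT.
- by apply: contraTneq xz => ->; rewrite lt_irr.
- by apply: contraTneq x'z => ->; rewrite lt_irr.
Qed.

Lemma no_upper_twins z z' x : z != z' -> lt^~ z =1 lt^~ z' -> lt x z -> False.
Proof.
move=> nzz' E xz; have xz' : lt x z' by have := E x => /= <-.
apply: (@no_open_twins z z' x) => //.
- apply/negP => /or3P[/eqP e|a|a]; first by rewrite e eqxx in nzz'.
    exact: no_chain3 xz a.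
  exact: no_chain3 xz' a.
- by move=> j; rewrite (nb_upper _ xz) (nb_upper _ xz'); congr (_%:R); rewrite E.
- by rewrite /cmp xz !orbT.
- by apply: contraTneq xz => ->; rewrite lt_irr.
- by apply: contraTneq xz' => ->; rewrite lt_irr.
Qed.

(* In a bipartite graph without induced matching of size 2 the neighbourhoods
   of one side form a chain; if moreover no two vertices have the same
   neighbourhood, the smallest one is a singleton. *)
Lemma leaf_exists (r : rel I) (x0 z0 : I) :
  (forall x z k l, r x z -> r k l -> ~~ r x l -> ~~ r k z -> False) ->
  (forall z z' x, z != z' -> r^~ z =1 r^~ z' -> r x z -> False) ->
  r x0 z0 ->
  exists x z, [/\ r x z, forall j, r x j -> j = z & forall a j, r a j -> r a z].
Proof.
move=> Hmatch Htwin r0.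
have P0 : [exists z, r x0 z] by apply/existsP; exists z0.
case: (@arg_minnP I x0 (fun x => [exists z, r x z]) (fun x => #|r x|) P0) => x /existsP[z xz] xmin.
have hub z' a j : r x z' -> r a j -> r a z'.
  move=> xz' aj; apply/negPn/negP => naz'.
  have /xmin le : [exists z, r a z] by apply/existsP; exists j.
  have : ~~ (r a \subset r x).
    apply/negP => sub; move: le; rewrite leqNgt => /negP; apply.
    by apply: proper_card; apply/properP; split=> //; exists z'.
  by case/subsetPn => l al nxl; exact: (Hmatch x z' a l).
exists x, z; split => // [j xj|a j aj]; last exact: hub xz aj.
apply/eqP/negPn/negP => jz; apply: (Htwin j z x) => // a.
by apply/idP/idP => H; [exact: hub xz H | exact: hub xj H].
Qed.

Lemma critical_antichain i j : ~~ lt i j.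
Proof.
apply/negP => ij.
have [x [z [xz xleaf zhub]]] := leaf_exists no_matching no_upper_twins ij.
have [y [w [/= wy yleaf whub]]] : exists y w, [/\ lt w y,
    forall j, lt j y -> j = w & forall a j, lt j a -> lt w a].
  apply: (@leaf_exists (fun a b => lt b a) j i) => //=.
  - by move=> p q k l pq kl nlp nqk; exact: (no_matching pq kl).
  - by move=> p q k npq E pk; exact: (no_lower_twins npq E pk).
have wz : lt w z by exact: zhub wy.
have ne p q : lt p q -> p != q.
  by move=> pq; apply: contraTneq pq => ->; rewrite lt_irr.
have nbx : nb x =1 (fun j => (j == z)%:R).
  move=> k; rewrite (nb_lower _ xz); congr (_%:R : R); congr nat_of_bool.
  by apply/idP/eqP => [/xleaf|->].
have nby : nb y =1 (fun j => (j == w)%:R).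
  move=> k; rewrite (nb_upper _ wy); congr (_%:R : R); congr nat_of_bool.
  by apply/idP/eqP => [/yleaf|->].
(* If the leaf below is itself the hub, [x] and [z] form an isolated edge and both have degree
   [u x + u z]. *)
have [xw|nxw] := eqVneq x w.
  have yz : y = z by apply: xleaf; rewrite xw.
  have := d_neq (ne _ _ xz); rewrite /cmp xz orbT => /(_ isT) /eqP; apply.
  rewrite !wdeg_nb; under eq_bigr do rewrite nbx.
  under [in RHS]eq_bigr do rewrite -yz nby.
  by rewrite !sum_pt -xw addrC.
have nyz : y != z.
  by apply: contra nxw => /eqP yz; apply/eqP/yleaf; rewrite yz.
have dwz : d w < d z.
  apply: (@leaf_deg x z w) => //.
  - by rewrite /cmp wz !orbT.
  - by rewrite eq_sym.
  - exact: ne.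
  - exact: ne.
  - apply/negP => /or3P[/eqP e|a|a]; first by rewrite e eqxx in nxw.
      exact: no_chain3 a wz.
    exact: no_chain3 a xz.
  (* [w] lies below every element that has something below it, so its open neighbourhood contains
     that of any [k] below [z]. *)
  move=> k zk kz.
  have {zk} kz' : lt k z.
    by case/or3P: zk => [/eqP e|a|//]; [rewrite e eqxx in kz | have := no_chain3 xz a].
  rewrite !wdeg_nb ![_ + _ - _]addrAC !subrr !add0r; apply: ler_sum => l _.
  apply: ler_wpM2r; [exact: ltW | rewrite (nb_lower _ kz') (nb_lower _ wz)].
  by case kl: (lt k l); [rewrite (whub _ _ kl) | rewrite ler0n].
have dzw : d z < d w.
  apply: (@leaf_deg y w z) => //.
  - by rewrite /cmp wz !orbT.
  - by rewrite eq_sym.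
  - by rewrite eq_sym; exact: ne.
  - by rewrite eq_sym; exact: ne.
  - apply/negP => /or3P[/eqP e|a|a]; first by rewrite e eqxx in nyz.
      exact: no_chain3 wy a.
    exact: no_chain3 xz a.
  move=> k wk kw.
  have {wk} wk' : lt w k.
    by case/or3P: wk => [/eqP e|//|a]; [rewrite e eqxx in kw | have := no_chain3 a wy].
  rewrite !wdeg_nb ![_ + _ - _]addrAC !subrr !add0r; apply: ler_sum => l _.
  apply: ler_wpM2r; [exact: ltW | rewrite (nb_upper _ wk') (nb_upper _ wz)].
  by case kl: (lt l k); [rewrite (zhub _ _ kl) | rewrite ler0n].
by have := Order.POrderTheory.lt_trans dwz dzw; rewrite ltxx.
Qed.

End CriticalPoint.

(** * Sums of squares and cubes *)

Section Blocks.
Variable R : realFieldType.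
Implicit Types (k N : nat) (s a b : R).

(* The square and cube sums of [k] blocks of length [(1 + s) / k.+1] and one
   block of length [(1 - k * s) / k.+1]. *)
Definition sq_blocks k s : R := (1 + k%:R * s ^+ 2) / k.+1%:R.
Definition cube_blocks k s : R :=
  (1 + 3 * k%:R * s ^+ 2 - k%:R * (k%:R - 1) * s ^+ 3) / k.+1%:R ^+ 2.

Lemma sq_blocksE k s : let n : R := k.+1%:R in
  sq_blocks k s = k%:R * ((1 + s) / n) ^+ 2 + ((1 - k%:R * s) / n) ^+ 2.
Proof.
rewrite /sq_blocks /= -(natr1 k); have := ler0n R k; move: (k%:R) => K K0.
by field; apply/eqP; lra.
Qed.

Lemma cube_blocksE k s : let n : R := k.+1%:R in
  cube_blocks k s = k%:R * ((1 + s) / n) ^+ 3 + ((1 - k%:R * s) / n) ^+ 3.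
Proof.
rewrite /cube_blocks /= -(natr1 k); have := ler0n R k; move: (k%:R) => K K0.
by field; apply/eqP; lra.
Qed.

(** Equality holds for [k] equal blocks, where the last block is empty; the difference is the square
    of the last block times a polynomial with visibly non-negative terms. *)
Lemma cube_blocks_sqr_le k s : (0 < k)%N -> 0 <= s -> k%:R * s <= 1 ->
  k%:R * cube_blocks k s ^+ 2 <= sq_blocks k s ^+ 3.
Proof.
move=> k0 s0 s1; rewrite cube_blocksE sq_blocksE /=.
have K1 : 1 <= k%:R :> R by rewrite ler1n.
have n0 : 0 < k.+1%:R :> R by rewrite ltr0n.
have ab : (1 - k%:R * s) / k.+1%:R <= (1 + s) / k.+1%:R.
  rewrite ler_pM2r ?invr_gt0 //; have : 0 <= k%:R * s by rewrite mulr_ge0 //; lra.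
  lra.
have b0 : 0 <= (1 - k%:R * s) / k.+1%:R by rewrite divr_ge0 ?ler0n //; lra.
move: ab b0; move: ((1 + s) / _) ((1 - _) / _) => a b ab b0.
move: (k%:R) K1 => K K1.
rewrite -subr_ge0.
have -> : (K * a ^+ 2 + b ^+ 2) ^+ 3 - K * (K * a ^+ 3 + b ^+ 3) ^+ 2 =
  b ^+ 2 * (K * a ^+ 3 * (K * (a + 2 * (a - b))) + (2 * K + 1) * (a ^+ 2 * b ^+ 2)
     + (K - 1) * b ^+ 2 * ((a - b) * (a + b))).
  ring.
have a0 : 0 <= a by lra.
have K0 : 0 <= K by lra.
apply: mulr_ge0; first exact: sqr_ge0.
by rewrite !addr_ge0 // !mulr_ge0 ?sqr_ge0 ?exprn_ge0 // ?mulr_ge0 //; lra.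
Qed.

Lemma sq_blocks_ge k s : 1 <= k.+1%:R * sq_blocks k s.
Proof.
rewrite /sq_blocks mulrCA divff ?pnatr_eq0 // mulr1 lerDl.
by rewrite mulr_ge0 ?sqr_ge0 // ler0n.
Qed.

Lemma sq_blocks_le k s : (0 < k)%N -> 0 <= s -> k%:R * s <= 1 ->
  k%:R * sq_blocks k s <= 1.
Proof.
move=> k0 s0 s1; rewrite /sq_blocks mulrA ler_pdivrMr ?ltr0n // mul1r -(natr1 k).
have : (k%:R * s) ^+ 2 <= 1 by rewrite expr_le1 // mulr_ge0 // ler0n.
by move: (k%:R : R) => K; lra.
Qed.

Lemma cube_blocks_ge0 k s : 0 <= s -> k%:R * s <= 1 -> 0 <= cube_blocks k s.
Proof.
move=> s0 s1; rewrite cube_blocksE /=.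
have n0 : 0 <= k.+1%:R :> R by rewrite ler0n.
have a0 : 0 <= (1 + s) / k.+1%:R by apply: divr_ge0 => //; lra.
have b0 : 0 <= (1 - k%:R * s) / k.+1%:R by apply: divr_ge0 => //; lra.
apply: addr_ge0; last exact: exprn_ge0.
by apply: mulr_ge0; [exact: ler0n | exact: exprn_ge0].
Qed.

(** With [S] the common sum of squares, [N * (N * a ^+ 3) ^+ 2 = S ^+ 3], so [cube_blocks_sqr_le]
    settles [N <= k]. If [N > k], then [N * S <= 1 <= k.+1 * S] forces [N = k.+1] and [s = 0], where
    both sides coincide. *)
Lemma equal_blocks_ge k s N a : (0 < k)%N -> 0 <= s -> k%:R * s <= 1 ->
  0 <= a -> N%:R * a <= 1 -> N%:R * a ^+ 2 = sq_blocks k s ->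
  cube_blocks k s <= N%:R * a ^+ 3.
Proof.
move=> k0 s0 s1 a0 Na1 Na2.
have p0 : 0 < sq_blocks k s.
  by rewrite -(@pmulr_rgt0 _ k.+1%:R) ?ltr0n // (lt_le_trans _ (sq_blocks_ge k s)).
have N0 : (0 < N)%N.
  by case: N Na2 {Na1} => // E; rewrite -E mul0r ltxx in p0.
have N0' : 0 < N%:R :> R by rewrite ltr0n.
have [Nk|kN] := leqP N k.
  have k0' : 0 < k%:R :> R by rewrite ltr0n.
  suff : cube_blocks k s ^+ 2 <= (N%:R * a ^+ 3) ^+ 2.
    by rewrite ler_sqr // nnegrE ?cube_blocks_ge0 // mulr_ge0 ?exprn_ge0 // ltW.
  rewrite -(ler_pM2l k0') (le_trans (cube_blocks_sqr_le k0 s0 s1)) // -Na2.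
  have -> : (N%:R * a ^+ 2) ^+ 3 = N%:R * (N%:R * a ^+ 3) ^+ 2 by ring.
  by rewrite ler_wpM2r ?sqr_ge0 // ler_nat.
have kN' : k.+1%:R <= N%:R :> R by rewrite ler_nat.
have h1 : (N%:R * a) ^+ 2 <= 1 by rewrite expr_le1 // mulr_ge0 // ltW.
have h2 : N%:R * sq_blocks k s <= 1 by rewrite -Na2; move: h1; lra.
have h3 := sq_blocks_ge k s.
have nN : k.+1%:R = N%:R :> R.
  apply: le_anti; rewrite kN' /= -(ler_pM2r p0); lra.
have e1 : k.+1%:R * sq_blocks k s = 1 by apply: le_anti; rewrite h3 nN h2.
have s00 : s = 0.
  move: e1; rewrite /sq_blocks mulrCA divff ?pnatr_eq0 // mulr1 => e1.
  have /eqP : k%:R * s ^+ 2 = 0 by lra.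
  by rewrite mulf_eq0 pnatr_eq0 eqn0Ngt k0 /= sqrf_eq0 => /eqP.
have Na : N%:R * a = 1.
  have E : (N%:R * a) ^+ 2 = 1 by rewrite -[RHS]e1 nN -Na2; ring.
  by have /eqP := E; rewrite sqrf_eq1 => /orP[] /eqP // E'; move: E'; have := mulr_ge0 (ltW N0') a0; lra.
have aE : a = N%:R^-1.
  by apply: (mulfI (lt0r_neq0 N0')); rewrite Na mulfV ?lt0r_neq0.
rewrite /cube_blocks s00 nN aE.
rewrite le_eqVlt; apply/orP; left; apply/eqP; field.
by rewrite lt0r_neq0.
Qed.

(** The sum of squares lies strictly between [1 / N.+1] and [1 / N], and weakly between [1 / k.+1]
    and [1 / k]. Hence [N = k] and [s = a - b], and the two sides are in fact equal. *)
Lemma two_blocks_ge k s N a b : (0 < k)%N -> 0 <= s -> k%:R * s <= 1 ->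
  (0 < N)%N -> 0 < b -> b < a -> N%:R * a + b = 1 ->
  N%:R * a ^+ 2 + b ^+ 2 = sq_blocks k s ->
  cube_blocks k s <= N%:R * a ^+ 3 + b ^+ 3.
Proof.
move=> k0 s0 s1 N0 b0 ba sum1 sq.
have N0' : 1 <= N%:R :> R by rewrite ler1n.
have p0 : 0 < sq_blocks k s.
  by rewrite -(@pmulr_rgt0 _ k.+1%:R) ?ltr0n // (lt_le_trans _ (sq_blocks_ge k s)).
have e1 : (N%:R * a + b) ^+ 2 = 1 by rewrite sum1 expr1n.
have b1 : 1 < N.+1%:R * sq_blocks k s.
  have i1 : (N%:R + 1) * (N%:R * a ^+ 2 + b ^+ 2) - (N%:R * a + b) ^+ 2
     = N%:R * (a - b) ^+ 2 by ring.
  have : 0 < N%:R * (a - b) ^+ 2 by rewrite mulr_gt0 ?exprn_gt0 //; lra.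
  by rewrite -i1 e1 -(natr1 N) -sq subr_gt0.
have b2 : N%:R * sq_blocks k s < 1.
  have i2 : (N%:R * a + b) ^+ 2 - N%:R * (N%:R * a ^+ 2 + b ^+ 2)
     = N%:R * b * (a + (a - b)) + b ^+ 2 by ring.
  have : 0 < N%:R * b * (a + (a - b)) + b ^+ 2.
    by rewrite addr_gt0 ?exprn_gt0 // !mulr_gt0 //; lra.
  by rewrite -i2 e1 sq subr_gt0.
have b3 := sq_blocks_ge k s; have b4 := sq_blocks_le k0 s0 s1.
have kN : (k < N.+1)%N by rewrite -(ltr_nat R) -(ltr_pM2r p0); lra.
have Nk : (N < k.+1)%N by rewrite -(ltr_nat R) -(ltr_pM2r p0); lra.
have NkE : N = k by apply/eqP; rewrite eqn_leq -ltnS Nk -ltnS kN.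
have sE : s = a - b.
  apply/eqP; rewrite -(@eqrXn2 _ 2) //; last by lra.
  have k0' : k%:R != 0 :> R by rewrite pnatr_eq0 -lt0n.
  apply/eqP/(mulfI k0').
  have i3 : k.+1%:R * sq_blocks k s - 1 = k%:R * s ^+ 2.
    rewrite /sq_blocks mulrCA divff ?pnatr_eq0 // mulr1; ring.
  have i4 : (k%:R + 1) * (k%:R * a ^+ 2 + b ^+ 2) - (k%:R * a + b) ^+ 2
     = k%:R * (a - b) ^+ 2 by ring.
  by rewrite -i3 -i4 -(natr1 k) -sq -NkE e1.
have sum1' : N%:R * a = 1 - b by rewrite -[in RHS]sum1; ring.
rewrite cube_blocksE -NkE.
have n0 : N.+1%:R != 0 :> R by rewrite pnatr_eq0.
have -> : 1 + s = a * N.+1%:R by rewrite -(natr1 N) sE mulrDr [a * _]mulrC sum1'; ring.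
have -> : 1 - N%:R * s = b * N.+1%:R by rewrite -(natr1 N) sE mulrBr sum1'; ring.
by rewrite !mulfK.
Qed.

End Blocks.

(** * First and second order conditions at a minimiser *)

Lemma quartic_near_gt0 (R : realType) (a b c d e : R) : 0 < a ->
  \forall t \near 0^'+, 0 < a + b * t + c * t ^+ 2 + d * t ^+ 3 + e * t ^+ 4.
Proof.
move=> a0; pose p := a%:P + b *: 'X + c *: 'X^2 + d *: 'X^3 + e *: 'X^4.
have pE t : p.[t] = a + b * t + c * t ^+ 2 + d * t ^+ 3 + e * t ^+ 4.
  by rewrite /p !hornerE.
have p0 : p.[0] = a by rewrite pE; ring.
have := cvg_at_right_filter (@continuous_horner R p 0).
rewrite p0 => /cvgr_gt => /(_ _ a0); apply: filterS => t Ht.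
by rewrite -pE; exact: Ht.
Qed.

Section KKT.
Variables (R : realType) (I : finType) (adj : rel I).
Hypothesis adjC : forall i j, adj i j = adj j i.
Variables (u : I -> R) (p : R).
Local Notation d := (wdeg adj u).
Local Notation F := (majd adj u).
Hypothesis u_gt0 : forall i, 0 < u i.
Hypothesis u_le1 : \sum_i u i <= 1.
Hypothesis u_edges : edges adj u = p.
Hypothesis u_min : forall x : I -> R, (forall i, 0 <= x i) -> \sum_i x i <= 1 ->
  p <= edges adj x -> cubic adj u u u <= cubic adj x x x.

(** The minimum is tested along the curve [u + t * v + t ^+ 2 * w]: a direction that only preserves
    the edges to first order may leave the feasible set at second order, and [w] corrects this. *)
Lemma path_min (v w : I -> R) :
  (\sum_i u i < 1) \/ (\sum_i v i <= 0 /\ \sum_i w i <= 0) ->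
  (0 < \sum_i d i * v i) \/
  (\sum_i d i * v i = 0 /\ 0 < 2 * (\sum_i d i * w i) + edges adj v) ->
  \forall t \near 0^'+, let x i := v i + t * w i in
    0 <= 3 * t * cubic adj x u u + 3 * t ^+ 2 * cubic adj x x u
         + t ^+ 3 * cubic adj x x x.
Proof.
move=> Hs Hd.
have P1 : \forall t \near 0^'+, forall i, 0 < u i + v i * t + w i * t ^+ 2.
  apply: filter_forall => i; have := quartic_near_gt0 (v i) (w i) 0 0 (u_gt0 i).
  by apply: filterS => t; rewrite !mul0r !addr0.
have P2 : \forall t \near 0^'+,
    \sum_i u i + (\sum_i v i) * t + (\sum_i w i) * t ^+ 2 <= 1.
  case: Hs => [lt1|[sv sw]].
    have := quartic_near_gt0 (- \sum_i v i) (- \sum_i w i) 0 0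
      (_ : 0 < 1 - \sum_i u i).
    rewrite subr_gt0 => /(_ lt1); apply: filterS => t; rewrite !mul0r !addr0.
    by move: (\sum_i u i) (\sum_i v i) (\sum_i w i) => *; lra.
  near=> t; have t0 : 0 < t by near: t; exact: nbhs_right_gt.
  have := mulr_le0_ge0 sv (ltW t0); have := mulr_le0_ge0 sw (sqr_ge0 t).
  by move: u_le1; move: (\sum_i u i) (\sum_i v i) (\sum_i w i) => *; lra.
pose E := \sum_i wdeg adj v i * w i.
have P3 : \forall t \near 0^'+, 0 < 2 * t * (\sum_i d i * v i)
   + t ^+ 2 * (2 * (\sum_i d i * w i) + edges adj v)
   + t ^+ 3 * (2 * E) + t ^+ 4 * edges adj w.
  case: Hd => [d0|[-> e0]].
    have d0' : 0 < 2 * \sum_i d i * v i by rewrite mulr_gt0.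
    have H := quartic_near_gt0 (2 * (\sum_i d i * w i) + edges adj v)
      (2 * E) (edges adj w) 0 d0'.
    near=> t; have t0 : 0 < t by near: t; exact: nbhs_right_gt.
    have : 0 < 2 * (\sum_i d i * v i) +
      (2 * (\sum_i d i * w i) + edges adj v) * t + 2 * E * t ^+ 2 +
      edges adj w * t ^+ 3 + 0 * t ^+ 4 by near: t.
    by move=> /(mulr_gt0 t0) /lt_le_trans; apply; rewrite le_eqVlt; apply/orP; left;
      apply/eqP; ring.
  have H := quartic_near_gt0 (2 * E) (edges adj w) 0 0 e0.
  near=> t; have t0 : 0 < t by near: t; exact: nbhs_right_gt.
  have : 0 < 2 * (\sum_i d i * w i) + edges adj v + 2 * E * t +
    edges adj w * t ^+ 2 + 0 * t ^+ 3 + 0 * t ^+ 4 by near: t.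
  by move=> /(mulr_gt0 (exprn_gt0 2 t0)) /lt_le_trans; apply;
    rewrite le_eqVlt; apply/orP; left; apply/eqP; ring.
near=> t; set x := fun i => v i + t * w i.
have t0 : 0 < t by near: t; exact: nbhs_right_gt.
have dx : \sum_i d i * x i = \sum_i d i * v i + t * \sum_i d i * w i.
  by rewrite mulr_sumr -big_split; apply: eq_bigr => i _; rewrite /x /=; ring.
have ux i : u i + t * x i = u i + v i * t + w i * t ^+ 2 by rewrite /x; ring.
have := @u_min (fun i => u i + t * x i); rewrite cubic_line // edges_line //.
rewrite dx edges_line // -/E u_edges -!addrA lerDl => H.
rewrite -(lerDl (cubic adj u u u)); apply: H.
- move=> i; rewrite ux ltW //; move: i; by near: t.
- have -> : \sum_i (u i + t * x i)
     = \sum_i u i + (\sum_i v i) * t + (\sum_i w i) * t ^+ 2.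
    rewrite !mulr_suml -!big_split; apply: eq_bigr => i _ /=; exact: ux.
  by near: t.
- apply: ltW; have : 0 < 2 * t * (\sum_i d i * v i)
    + t ^+ 2 * (2 * (\sum_i d i * w i) + edges adj v)
    + t ^+ 3 * (2 * E) + t ^+ 4 * edges adj w by near: t.
  by move=> /lt_le_trans; apply; rewrite le_eqVlt; apply/orP; left; apply/eqP; ring.
Unshelve. all: by end_near.
Qed.

Lemma first_order (v : I -> R) : (\sum_i u i < 1) \/ (\sum_i v i <= 0) ->
  0 < \sum_i d i * v i -> 0 <= \sum_i F i * v i.
Proof.
move=> Hs dv; rewrite -(cubic_majd adj u v) leNgt; apply/negP => neg.
have Hs' : (\sum_i u i < 1) \/ (\sum_i v i <= 0 /\ \sum_(i : I) 0 <= 0 :> R).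
  by case: Hs => ?; [left | right; rewrite big1_eq].
have H1 := path_min Hs' (or_introl dv).
have H2 := quartic_near_gt0 (- (3 * cubic adj v v u)) (- cubic adj v v v) 0 0
   (_ : 0 < - (3 * cubic adj v u u)).
have {}H2 := H2 ltac:(by rewrite oppr_gt0 pmulr_rlt0).
near (0 : R)^'+ => t.
have t0 : 0 < t by near: t; exact: nbhs_right_gt.
have : 0 < - (3 * cubic adj v u u) + - (3 * cubic adj v v u) * t +
   - cubic adj v v v * t ^+ 2 + 0 * t ^+ 3 + 0 * t ^+ 4 by near: t.
have /= : let x i := v i + t * 0 in
    0 <= 3 * t * cubic adj x u u + 3 * t ^+ 2 * cubic adj x x u
         + t ^+ 3 * cubic adj x x x by near: t.
have -> : (fun i => v i + t * 0) = v by apply/funext => i; rewrite mulr0 addr0.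
by move=> A /(mulr_gt0 t0) B; move: A B; lra.
Unshelve. all: by end_near.
Qed.

Lemma second_order (v w : I -> R) : \sum_i v i <= 0 -> \sum_i w i <= 0 ->
  \sum_i d i * v i = 0 -> \sum_i F i * v i = 0 ->
  0 < 2 * (\sum_i d i * w i) + edges adj v ->
  0 <= \sum_i F i * w i + cubic adj v v u.
Proof.
move=> sv sw dv Fv H; rewrite leNgt; apply/negP => neg.
have H1 := path_min (or_intror (conj sv sw)) (or_intror (conj dv H)).
have H2 := quartic_near_gt0
  (- (6 * cubic adj v w u + cubic adj v v v))
  (- (3 * cubic adj w w u + 3 * cubic adj w v v))
  (- (3 * cubic adj w w v)) (- cubic adj w w w)
   (_ : 0 < - (3 * (\sum_i F i * w i + cubic adj v v u))).
have {}H2 := H2 ltac:(by rewrite oppr_gt0 pmulr_rlt0).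
near (0 : R)^'+ => t.
have t0 : 0 < t by near: t; exact: nbhs_right_gt.
have : 0 < - (3 * (\sum_i F i * w i + cubic adj v v u)) +
  - (6 * cubic adj v w u + cubic adj v v v) * t +
  - (3 * cubic adj w w u + 3 * cubic adj w v v) * t ^+ 2 +
  - (3 * cubic adj w w v) * t ^+ 3 + - cubic adj w w w * t ^+ 4 by near: t.
have /= : let x i := v i + t * w i in
    0 <= 3 * t * cubic adj x u u + 3 * t ^+ 2 * cubic adj x x u
         + t ^+ 3 * cubic adj x x x by near: t.
rewrite cubic_line //.
have -> : cubic adj (fun i => v i + t * w i) (fun i => v i + t * w i) u =
  cubic adj v v u + 2 * t * cubic adj v w u + t ^+ 2 * cubic adj w w u.
  rewrite cubicD ![cubic adj _ (fun i => v i + t * w i) u]cubicC12 // !cubicD.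
  by rewrite (cubicC12 adjC w v u); ring.
rewrite cubicD !cubic_majd Fv => A /(mulr_gt0 (exprn_gt0 2 t0)) B.
by move: A B; lra.
Unshelve. all: by end_near.
Qed.

(** Distinct degrees make the gradients of the two constraints independent. Concretely, shifting
    weight from [i1] to [i2] preserves the mass and strictly gains edges, so a small multiple of it
    makes any direction that merely preserves the edges feasible. *)
Lemma kkt (i1 i2 : I) : d i1 < d i2 -> exists h c : R,
  [/\ 0 <= c, \sum_i u i < 1 -> c = 0, forall k, F k = 2 * h * d k - c &
      forall v : I -> R, \sum_i v i = 0 -> \sum_i d i * v i = 0 ->
        0 <= cubic adj v v u - h * edges adj v].
Proof.
move=> d12.
have eps (a b : R) : (forall e, 0 < e -> 0 <= a + e * b) -> 0 <= a.
  move=> H; rewrite leNgt; apply/negP => a0.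
  have := H (- a / (2 * (`|b| + 1))).
  have b1 : 0 < 2 * (`|b| + 1) by rewrite mulr_gt0 // ltr_wpDl.
  rewrite divr_gt0 ?oppr_gt0 // => /(_ isT).
  have : - a / (2 * (`|b| + 1)) * b <= - a / 2.
    rewrite -mulrA ler_pM2l ?oppr_gt0 // mulrC ler_pdivrMr // mulrA mulVf ?pnatr_eq0 //.
    by have := ler_norm b; lra.
  lra.
pose w0 : I -> R := pt4 1 (-1) 0 0 i2 i1 i1 i1.
have Gpt (G : I -> R) (a b e g : R) (i j k l : I) :
    \sum_x G x * pt4 a b e g i j k l x = a * G i + b * G j + e * G k + g * G l.
  by rewrite -sum_pt4; apply: eq_bigr => x _; rewrite mulrC.
have sw0 : \sum_x w0 x = 0 by rewrite sum_pt4_1; ring.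
have dw0 : \sum_x d x * w0 x = d i2 - d i1 by rewrite Gpt; ring.
have Fw0 : \sum_x F x * w0 x = F i2 - F i1 by rewrite Gpt; ring.
have FO v : (\sum_i u i < 1) \/ (\sum_i v i <= 0) ->
    \sum_i d i * v i = 0 -> 0 <= \sum_i F i * v i.
  move=> Hs dv; apply: (eps _ (F i2 - F i1)) => e e0.
  have lin (G : I -> R) : \sum_i G i * (v i + e * w0 i)
      = \sum_i G i * v i + e * \sum_i G i * w0 i.
    by rewrite mulr_sumr -big_split; apply: eq_bigr => i _ /=; ring.
  rewrite -Fw0 -lin; apply: first_order; last first.
    by rewrite lin dv dw0 add0r mulr_gt0 // subr_gt0.
  case: Hs => Hs; [by left | right].
  have := lin (fun=> 1); under eq_bigr do rewrite mul1r.
  under [in RHS]eq_bigr do rewrite mul1r; move=> ->.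
  by under [X in e * X]eq_bigr do rewrite mul1r; rewrite sw0 mulr0 addr0.
have dd : 0 < d i2 - d i1 by rewrite subr_gt0.
pose h := (F i2 - F i1) / (2 * (d i2 - d i1)).
pose c := 2 * h * d i1 - F i1.
have hE : 2 * h * (d i2 - d i1) = F i2 - F i1.
  by rewrite /h; field; rewrite gt_eqF.
have FO0 v : \sum_i v i = 0 -> \sum_i d i * v i = 0 -> \sum_i F i * v i = 0.
  move=> sv dv; apply: le_anti; apply/andP; split; last first.
    by apply: FO => //; right; rewrite sv.
  rewrite -oppr_ge0 -sumrN.
  have -> : \sum_i - (F i * v i) = \sum_i F i * (- v i).
    by apply: eq_bigr => i _; rewrite mulrN.
  apply: FO; first by right; rewrite sumrN sv oppr0.
  by rewrite -[RHS]oppr0 -[X in _ = - X]dv -sumrN; apply: eq_bigr => i _; rewrite mulrN.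
have Fk k : F k = 2 * h * d k - c.
  pose al := (d k - d i1) / (d i2 - d i1).
  have alE : al * (d i2 - d i1) = d k - d i1 by rewrite /al mulfVK ?gt_eqF.
  have := FO0 (pt4 1 (- al) (al - 1) 0 k i2 i1 i1).
  rewrite sum_pt4_1 !Gpt => A.
  have {}A : 1 * F k + - al * F i2 + (al - 1) * F i1 + 0 * F i1 = 0.
    by apply: A; [ring | move: alE; lra].
  have -> : F k = F i1 + al * (F i2 - F i1) by move: A; lra.
  by rewrite -hE /c mulrCA alE; ring.
(* Removes one unit of mass and preserves the edges to first order, so that [F] paired with it is
   exactly [c]. *)
pose v1 : I -> R := pt4 (d i1 / (d i2 - d i1)) (- (d i2 / (d i2 - d i1))) 0 0 i2 i1 i1 i1.
have sv1 : \sum_x v1 x = -1.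
  by rewrite sum_pt4_1; field; rewrite gt_eqF.
have dv1 : \sum_x d x * v1 x = 0 by rewrite Gpt; field; rewrite gt_eqF.
have Fv (v : I -> R) : \sum_x F x * v x = 2 * h * (\sum_x d x * v x) - c * \sum_x v x.
  by rewrite !mulr_sumr -sumrB; apply: eq_bigr => x _; rewrite Fk; ring.
have c0 : 0 <= c.
  by have := FO v1 (or_intror _); rewrite sv1 Fv dv1 sv1 => H; have := H ltac:(lra) erefl; lra.
exists h, c; split => //.
  move=> lt1; have : 0 <= \sum_i F i * (- v1 i).
    apply: FO; first by left.
    by rewrite -[RHS]oppr0 -[X in _ = - X]dv1 -sumrN; apply: eq_bigr => i _; rewrite mulrN.
  have -> : \sum_i F i * (- v1 i) = - \sum_i F i * v1 i.
    by rewrite -sumrN; apply: eq_bigr => i _; rewrite mulrN.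
  by rewrite Fv dv1 sv1 => ?; lra.
move=> v sv dv; apply: (eps _ h) => e e0.
(* Chosen so that the second order gain of edges along [v] and [kap * w0] is exactly [e]. *)
pose kap := (e - edges adj v) / (2 * (d i2 - d i1)).
have kE : 2 * (kap * (d i2 - d i1)) = e - edges adj v.
  by rewrite /kap; field; rewrite gt_eqF.
have kw (G : I -> R) : \sum_i G i * (kap * w0 i) = kap * \sum_i G i * w0 i.
  by rewrite mulr_sumr; apply: eq_bigr => i _; ring.
have := @second_order v (fun i => kap * w0 i).
rewrite sv dv (FO0 v sv dv) -mulr_sumr sw0 mulr0 !kw dw0 Fw0 kE => H.
have {H} := H ltac:(lra) ltac:(lra) erefl erefl ltac:(lra).
have -> : kap * (F i2 - F i1) = h * (e - edges adj v) by rewrite -hE -kE; ring.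
lra.
Unshelve. all: by end_near.
Qed.

End KKT.

(** * The bound for weighted posets *)

Section Minimizer.
Variables (R : realType) (N : nat) (adj : rel 'I_N).

Let continuous_sum (T : topologicalType) (I : finType) (G : I -> T -> R) :
  (forall i, continuous (G i)) -> continuous (fun x => \sum_i G i x).
Proof.
move=> cG; apply: continuous_big => [|i _]; [exact: add_continuous | exact: cG].
Qed.

Let coord_cont i : continuous (fun v : 'rV[R]_N => v ord0 i).
Proof. exact: coord_continuous. Qed.

Let continuous_mul (T : topologicalType) (f g : T -> R) :
  continuous f -> continuous g -> continuous (fun x => f x * g x).
Proof. by move=> cf cg x; apply: cvgM; [exact: cf | exact: cg]. Qed.

Lemma edges_continuous : continuous (fun v : 'rV[R]_N => edges adj (v ord0)).
Proof.
apply: continuous_sum => i; apply: continuous_sum => j.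
apply: continuous_mul; last exact: coord_cont.
by apply: continuous_mul; [exact: cst_continuous | exact: coord_cont].
Qed.

Lemma cubic_continuous :
  continuous (fun v : 'rV[R]_N => cubic adj (v ord0) (v ord0) (v ord0)).
Proof.
apply: continuous_sum => i; apply: continuous_sum => j; apply: continuous_sum => k.
apply: continuous_mul; last exact: coord_cont.
apply: continuous_mul; last exact: coord_cont.
by apply: continuous_mul; [exact: cst_continuous | exact: coord_cont].
Qed.

Definition feasible (p : R) (u : 'I_N -> R) :=
  [/\ forall i, 0 <= u i, \sum_i u i <= 1 & p <= edges adj u].

Lemma cubic_minimizer (p : R) (u0 : 'I_N -> R) : feasible p u0 ->
  exists2 u, feasible p u & forall x, feasible p x ->
    cubic adj u u u <= cubic adj x x x.
Proof.
move=> f0.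
pose row_of u : 'rV[R]_N := \row_i u i.
have rowK u : row_of u ord0 = u by apply/funext => i; rewrite mxE.
pose K := [set v : 'rV[R]_N | feasible p (v ord0)].
have K0 : K !=set0 by exists (row_of u0); rewrite /K /= rowK.
have cK : compact K.
  have cube : compact [set v : 'rV[R]_N | forall i, `[0, 1]%classic (v ord0 i)].
    apply: (@rV_compact R N (fun=> `[0, 1]%classic)) => _; exact: segment_compact.
  apply: (subclosed_compact _ cube); last first.
    move=> v [v0 v1 _] i /=; rewrite in_itv /= v0 /=.
    by apply: le_trans v1; rewrite (bigD1 i) //= lerDl sumr_ge0.
  have -> : K = (\bigcap_(i : 'I_N) [set v : 'rV[R]_N | 0 <= v ord0 i]) `&`
      ([set v : 'rV[R]_N | \sum_i v ord0 i <= 1] `&` [set v : 'rV[R]_N | p <= edges adj (v ord0)]).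
    apply/seteqP; split => v /=; first by move=> [A B C]; split; [move=> i _; exact: A | split].
    by move=> [A [B C]]; split => // i; exact: A.
  apply: closedI.
    apply: closed_bigI => i _.
    by have ci := @coord_cont i; move/continuous_closedP : ci => /(_ _ (@closed_ge R 0)).
  apply: closedI.
    have cs : continuous (fun v : 'rV[R]_N => \sum_i v ord0 i).
      by apply: continuous_sum => i; exact: coord_cont.
    by move/continuous_closedP : cs => /(_ _ (@closed_le R 1)).
  by have ce := @edges_continuous; move/continuous_closedP : ce => /(_ _ (@closed_ge R p)).
have [v /set_mem Kv vmin] :=
  compact_EVT_min K0 cK (continuous_subspaceT cubic_continuous).
exists (v ord0) => // x fx.
have := vmin (row_of x); rewrite rowK; apply; apply/mem_set.
by rewrite /K /= rowK.
Qed.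

End Minimizer.

(** * Deleting, merging and rescaling weights *)

Section Moves.
Variable R : realType.

Lemma edges_delete N (adj : rel 'I_N.+1) (u : 'I_N.+1 -> R) k : u k = 0 ->
  edges adj u = edges (fun a b => adj (lift k a) (lift k b)) (fun a => u (lift k a)).
Proof.
move=> uk; rewrite /edges (bigD1_ord k) //= big1 ?add0r; last first.
  by move=> j _; rewrite uk mulr0 mul0r.
apply: eq_bigr => i _; rewrite (bigD1_ord k) //= uk mulr0 add0r.
by apply: eq_bigr.
Qed.

Lemma cubic_delete N (adj : rel 'I_N.+1) (u : 'I_N.+1 -> R) k : u k = 0 ->
  let adj' a b := adj (lift k a) (lift k b) in let u' a := u (lift k a) in
  cubic adj u u u = cubic adj' u' u' u'.
Proof.
move=> uk /=; rewrite /cubic (bigD1_ord k) //= big1 ?add0r; last first.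
  by move=> j _; apply: big1 => l _; rewrite uk mulr0 !mul0r.
apply: eq_bigr => i _; rewrite (bigD1_ord k) //= big1 ?add0r; last first.
  by move=> l _; rewrite uk mulr0 mul0r.
apply: eq_bigr => j _; rewrite (bigD1_ord k) //= uk mulr0 add0r.
by apply: eq_bigr.
Qed.

Lemma cubic_ge_cubes (I : finType) (adj : rel I) (u : I -> R) :
  (forall i, adj i i) -> (forall i, 0 <= u i) -> \sum_i u i ^+ 3 <= cubic adj u u u.
Proof.
move=> adjR u0.
have m0 i j k : 0 <= maj R adj i j k * u i * u j * u k.
  rewrite !mulr_ge0 // /maj /amx.
  by case: (adj i j); case: (adj j k); case: (adj i k) => /=; lra.
apply: ler_sum => i _; rewrite (bigD1 i) //= (bigD1 i) //= -addrA.
rewrite {1}/maj /amx adjR /=.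
have -> : (1 * 1 + 1 * 1 + 1 * 1 - 2 * (1 * 1 * 1)) * u i * u i * u i = u i ^+ 3 by ring.
by rewrite lerDl addr_ge0 // sumr_ge0 // => j _; rewrite sumr_ge0.
Qed.

(* Moving weight between two adjacent vertices of equal degree keeps the number
   of edges and is a concave move for the cubic form, so one of them may be
   emptied. *)
Lemma merge_adjacent N (adj : rel 'I_N) (p : R) (u : 'I_N -> R) i j :
  (forall a b, adj a b = adj b a) -> (forall a, adj a a) ->
  feasible adj p u -> i != j -> adj i j -> wdeg adj u i = wdeg adj u j ->
  exists u' k, [/\ feasible adj p u', u' k = 0 &
                   cubic adj u' u' u' <= cubic adj u u u].
Proof.
move=> adjC adjR fu.
wlog le : i j / majd adj u i <= majd adj u j.
  move=> H ij aij dij; have [le|/ltW le] := leP (majd adj u i) (majd adj u j).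
    exact: (H i j).
  by apply: (H j i) => //; rewrite 1?eq_sym 1?adjC.
move=> ij aij dij; have [u0 u1 up] := fu.
pose v : 'I_N -> R := pt4 1 (-1) 0 0 i j i i.
have aji : adj j i by rewrite adjC.
have vE x : v x = (x == i)%:R - (x == j)%:R by rewrite /v /pt4; ring.
have ev : edges adj v = 0.
  by rewrite edges_pt4 /amx !adjR aij aji /=; ring.
have dv : \sum_x wdeg adj u x * v x = 0.
  under eq_bigr do rewrite mulrC.
  by rewrite sum_pt4 dij; ring.
have Fv : cubic adj v u u = majd adj u i - majd adj u j.
  rewrite cubic_majd; under eq_bigr do rewrite mulrC.
  by rewrite sum_pt4; ring.
have vvu (x : 'I_N -> R) : cubic adj v v x = - \sum_k x k * (amx R adj i k - amx R adj j k) ^+ 2.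
  rewrite cubic_pt4 !majwE !adjR aij aji !wcod_id // (wcodC _ _ j i) /wdeg /wcod.
  have -> : \sum_k x k * (amx R adj i k - amx R adj j k) ^+ 2 =
     \sum_k amx R adj i k * x k + \sum_k amx R adj j k * x k
        - 2 * \sum_k x k * amx R adj i k * amx R adj j k.
    rewrite mulr_sumr -big_split /= -sumrB; apply: eq_bigr => k _.
    by rewrite /amx; case: (adj i k); case: (adj j k) => /=; ring.
  ring.
(* Both [i] and [j] are adjacent to [i] and to [j], so the symmetric difference of their closed
   neighbourhoods misses the support of [v]. *)
have vvv : cubic adj v v v = 0.
  rewrite vvu big1 ?oppr0 // => k _; rewrite vE.
  have [->|ki] := eqVneq k i; first by rewrite /amx adjR aji subrr expr0n mulr0.
  have [->|kj] := eqVneq k j; first by rewrite /amx adjR aij subrr expr0n mulr0.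
  by rewrite subrr mul0r.
exists (fun x => u x + u j * v x), j; split.
- split.
  + move=> x; rewrite vE; have := u0 x; have := u0 j.
    have [->|xi] := eqVneq x i; first by rewrite (negbTE ij) /=; lra.
    by have [->|xj] /= := eqVneq x j; lra.
  + rewrite big_split /= -mulr_sumr.
    have -> : \sum_x v x = 0 by rewrite sum_pt4_1; ring.
    by rewrite mulr0 addr0.
  + by rewrite edges_line // dv ev !mulr0 !addr0.
- by rewrite vE eqxx eq_sym (negbTE ij) /=; ring.
- rewrite cubic_line // Fv vvu vvv mulr0 addr0 -addrA gerDl.
  have uj := u0 j.
  have A : 3 * u j * (majd adj u i - majd adj u j) <= 0.
    by apply: mulr_ge0_le0; [lra | rewrite subr_le0].
  have B : 3 * u j ^+ 2 * - (\sum_k u k * (amx R adj i k - amx R adj j k) ^+ 2) <= 0.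
    apply: mulr_ge0_le0; first by rewrite mulr_ge0 // sqr_ge0.
    by rewrite oppr_le0 sumr_ge0 // => k _; rewrite mulr_ge0 ?sqr_ge0.
  lra.
Qed.

Lemma edges_scale (I : finType) (adj : rel I) (u : I -> R) t :
  edges adj (fun i => t * u i) = t ^+ 2 * edges adj u.
Proof.
rewrite /edges mulr_sumr; apply: eq_bigr => i _; rewrite mulr_sumr.
by apply: eq_bigr => j _; ring.
Qed.

Lemma cubic_scale (I : finType) (adj : rel I) (u : I -> R) t :
  let w i := t * u i in cubic adj w w w = t ^+ 3 * cubic adj u u u.
Proof.
rewrite /cubic mulr_sumr; apply: eq_bigr => i _; rewrite mulr_sumr.
apply: eq_bigr => j _; rewrite mulr_sumr; apply: eq_bigr => k _; ring.
Qed.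

(** A surplus of edges could be removed by shrinking [u], which multiplies the positive value of the
    cubic form by [t ^+ 3 < 1]. *)
Lemma min_edges_eq N (adj : rel 'I_N) (p : R) (u : 'I_N -> R) : 0 < p ->
  (forall i, adj i i) -> (forall i, 0 < u i) -> feasible adj p u ->
  (forall x, feasible adj p x -> cubic adj u u u <= cubic adj x x x) ->
  edges adj u = p.
Proof.
move=> p0 adjR u_gt0 [u0 u1 up] umin; apply/eqP; rewrite eq_le up andbT.
rewrite leNgt; apply/negP => lt.
have e0 : 0 < edges adj u by exact: lt_trans lt.
have [i0 _|N0] := pickP 'I_N; last first.
  by move: e0; rewrite /edges big1 ?ltxx // => i; have := N0 i.
pose t := Num.sqrt (p / edges adj u).
have t0 : 0 <= t by exact: sqrtr_ge0.
have t2 : t ^+ 2 = p / edges adj u by rewrite sqr_sqrtr // divr_ge0 ?ltW.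
have t1 : t < 1.
  rewrite -(@ltr_pXn2r _ 2) ?nnegrE // expr1n t2.
  by rewrite ltr_pdivrMr // mul1r.
have c0 : 0 < cubic adj u u u.
  apply: lt_le_trans (cubic_ge_cubes adjR u0).
  rewrite (bigD1 i0) //= ltr_pwDl ?exprn_gt0 // sumr_ge0 // => i _.
  by rewrite exprn_ge0.
have := umin (fun i => t * u i); rewrite cubic_scale => H.
have : cubic adj u u u <= t ^+ 3 * cubic adj u u u.
  apply: H; split.
  - by move=> i; rewrite mulr_ge0.
  - rewrite -mulr_sumr; apply: le_trans u1.
    by rewrite ler_piMl ?sumr_ge0 // ltW.
  - by rewrite edges_scale t2 mulfVK // gt_eqF.
rewrite ler_pMl // leNgt => /negP; apply.
by rewrite exprn_ilt1.
Qed.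

End Moves.

(** * The forms on an antichain *)

Section Antichain.
Variables (R : realType) (I : finType) (lt : rel I).
Hypothesis anti : forall i j, ~~ lt i j.

Lemma cmp_antichain i j : cmp lt i j = (i == j).
Proof. by rewrite /cmp (negbTE (anti i j)) (negbTE (anti j i)) !orbF. Qed.

Lemma wdeg_antichain (u : I -> R) i : wdeg (cmp lt) u i = u i.
Proof.
rewrite -[RHS](sum_pt u i); apply: eq_bigr => j _.
by rewrite /amx cmp_antichain eq_sym.
Qed.

Lemma edges_antichain (u : I -> R) : edges (cmp lt) u = \sum_i u i ^+ 2.
Proof.
apply: eq_bigr => i _; rewrite -[RHS](sum_pt (fun j => u i * u j) i).
by apply: eq_bigr => j _; rewrite /amx cmp_antichain eq_sym -mulrA.
Qed.

Lemma wcod_antichain (u : I -> R) i j : wcod (cmp lt) u i j = (i == j)%:R * u i.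
Proof.
rewrite -[RHS](sum_pt (fun k => (k == j)%:R * u k) i); apply: eq_bigr => k _.
by rewrite /amx !cmp_antichain ![_ == k]eq_sym; ring.
Qed.

Lemma majw_antichain (u : I -> R) i j : majw (cmp lt) u i j = (i == j)%:R * u i.
Proof.
rewrite majwE cmp_antichain wcod_antichain !wdeg_antichain.
by have [->|_] /= := eqVneq i j; ring.
Qed.

Lemma majd_antichain (u : I -> R) i : majd (cmp lt) u i = u i ^+ 2.
Proof.
rewrite -[RHS](sum_pt (fun j => u i * u j) i); apply: eq_bigr => j _.
by rewrite majw_antichain eq_sym -mulrA.
Qed.

Lemma cubic_antichain (u : I -> R) : cubic (cmp lt) u u u = \sum_i u i ^+ 3.
Proof.
by rewrite cubic_majd; apply: eq_bigr => i _; rewrite majd_antichain -exprSr.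
Qed.

End Antichain.

Section PosetBound.
Variables (R : realType) (k : nat) (s : R).
Hypotheses (k_gt0 : (0 < k)%N) (s_ge0 : 0 <= s) (s_le : k%:R * s <= 1).
Let p := sq_blocks k s.

Lemma sq_blocks_gt0 : 0 < p.
Proof.
by rewrite -(@pmulr_rgt0 _ k.+1%:R) ?ltr0n // (lt_le_trans _ (sq_blocks_ge k s)).
Qed.

(** Induction on the size stands in for the choice of a smallest support: once the minimiser, or a
    point at least as good, has a zero weight, that element is deleted. *)
Lemma poset_bound_ord N (lt : rel 'I_N) (u : 'I_N -> R) :
  irreflexive lt -> transitive lt -> feasible (cmp lt) p u ->
  cube_blocks k s <= cubic (cmp lt) u u u.
Proof.
elim: N lt u => [|N IHN] lt u0 lt_irr lt_trans.
  by move=> [_ _]; rewrite /edges big_ord0 leNgt sq_blocks_gt0.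
have IH x i : feasible (cmp lt) p x -> x i = 0 ->
    cube_blocks k s <= cubic (cmp lt) x x x.
  move=> [x0 x1 xp] xi; rewrite (cubic_delete _ xi).
  pose lt' a b := lt (lift i a) (lift i b).
  have E : (fun a b => cmp lt (lift i a) (lift i b)) = cmp lt'.
    by apply/funext => a; apply/funext => b; rewrite /cmp (inj_eq lift_inj).
  rewrite E; apply: IHN.
  - by move=> a; rewrite /lt' lt_irr.
  - by move=> b a c; exact: lt_trans.
  split => //.
    by move: x1; rewrite (bigD1_ord i) //= xi add0r.
  by rewrite -E -(edges_delete _ xi).
move=> f0; have [u fu umin] := cubic_minimizer f0.
apply: le_trans (umin _ f0).
have [u_ge0 u_le1 up] := fu.
have [[i ui]|npos] := pselect (exists i, u i = 0); first exact: IH ui.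
have u_gt0 i : 0 < u i.
  rewrite lt_neqAle u_ge0 andbT eq_sym; apply/eqP => ui.
  by apply: npos; exists i.
have [[i [j [nij aij dij]]]|nd] := pselect (exists i j,
    [/\ i != j, cmp lt i j & wdeg (cmp lt) u i = wdeg (cmp lt) u j]).
  have [u' [l [fu' u'l le]]] :=
    merge_adjacent (cmpC lt) (cmpR lt) fu nij aij dij.
  exact: le_trans (IH _ _ fu' u'l) le.
have d_neq i j : i != j -> cmp lt i j -> wdeg (cmp lt) u i != wdeg (cmp lt) u j.
  by move=> nij aij; apply/eqP => dij; apply: nd; exists i, j.
have {}up := min_edges_eq sq_blocks_gt0 (cmpR lt) u_gt0 fu umin.
have umin' x : (forall i, 0 <= x i) -> \sum_i x i <= 1 -> p <= edges (cmp lt) x ->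
  cubic (cmp lt) u u u <= cubic (cmp lt) x x x by move=> *; exact: umin.
(* The multiplier rule needs two distinct degrees. If all degrees are equal, [d_neq] by itself rules
   out comparable pairs. *)
have [[i1 [i2 d12]]|deq] := pselect (exists i1 i2,
    wdeg (cmp lt) u i1 < wdeg (cmp lt) u i2).
  have [h [c [c0 c1 grad hess]]] :=
    kkt (cmpC lt) u_gt0 u_le1 up umin' d12.
  have anti := critical_antichain lt_irr lt_trans u_gt0 c0 grad hess d_neq.
  rewrite !wdeg_antichain // in d12.
  set b := u i1 in d12; set a := u i2 in d12.
  have qa : a ^+ 2 = 2 * h * a - c.
    by have := grad i2; rewrite majd_antichain // wdeg_antichain.
  have qb : b ^+ 2 = 2 * h * b - c.
    by have := grad i1; rewrite majd_antichain // wdeg_antichain.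
  have hE : 2 * h = a + b.
    have n0 : a - b != 0 by rewrite subr_eq0 gt_eqF.
    by apply: (mulIf n0); move: qa qb; lra.
  have cE : c = a * b by move: qa; rewrite hE; lra.
  have b0 : 0 < b by exact: u_gt0.
  (* Every weight is a root of [x ^+ 2 = 2 * h * x - c], hence [a] or [b]. A second weight [b] would
     contradict the second order condition for shifting weight between the two, because
     [b - h < 0]. *)
  have uE j : j != i1 -> u j = a.
    move=> ji1; have : (u j - a) * (u j - b) = 0.
      have := grad j; rewrite majd_antichain // wdeg_antichain // hE cE; lra.
    move/eqP; rewrite mulf_eq0 !subr_eq0 => /orP[/eqP //|/eqP ub].
    have := hess (pt4 1 (-1) 0 0 j i1 j j).
    rewrite sum_pt4_1; under eq_bigr do rewrite mulrC.
    rewrite sum_pt4 !wdeg_antichain // cubic_pt4 edges_pt4 !majw_antichain //.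
    rewrite /amx !cmp_antichain // !eqxx (negbTE ji1) eq_sym (negbTE ji1) ub -/b /=.
    move=> /(_ ltac:(ring) ltac:(ring)); lra.
  (* The multiplier [c = a * b] is positive, so the mass constraint is active. *)
  have sum1 : \sum_i u i = 1.
    apply/eqP; rewrite eq_le u_le1 leNgt; apply/negP => /c1; rewrite cE.
    by apply/eqP; rewrite gt_eqF // mulr_gt0 // (le_lt_trans (ltW b0)). 
  have sumE (G : R -> R) : \sum_i G (u i) = N%:R * G a + G b.
    rewrite (bigD1_ord i1) //= addrC; congr (_ + _).
    rewrite (eq_bigr (fun=> G a)) => [|i _]; last by rewrite uE // eq_sym neq_lift.
    by rewrite sumr_const card_ord mulr_natl.
  rewrite cubic_antichain // (sumE (fun x => x ^+ 3)).
  apply: two_blocks_ge => //.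
  - have : i2 != i1 by apply: contraTneq d12 => E; rewrite /a /b E ltxx.
    by case: (N) i1 i2 {d12 a b qa qb hE cE b0 uE sum1 sumE} => // i j; rewrite !ord1.
  - by rewrite -(sumE id).
  - by rewrite -(sumE (fun x => x ^+ 2)) -(edges_antichain anti).
have deq' i j : wdeg (cmp lt) u i = wdeg (cmp lt) u j.
  apply: le_anti; rewrite !leNgt; apply/andP; split; apply/negP => H.
    by apply: deq; exists j, i.
  by apply: deq; exists i, j.
have anti i j : ~~ lt i j.
  apply/negP => ij; have := @d_neq i j; rewrite (deq' i j) /cmp ij orbT eqxx.
  have -> : i != j by apply: contraTneq ij => ->; rewrite lt_irr.
  by move=> /(_ isT isT).
pose a := u ord0.
have uE j : u j = a by have := deq' j ord0; rewrite !wdeg_antichain.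
have sumE (G : R -> R) : \sum_i G (u i) = N.+1%:R * G a.
  rewrite (eq_bigr (fun=> G a)) => [|i _]; last by rewrite uE.
  by rewrite sumr_const card_ord mulr_natl.
rewrite cubic_antichain // (sumE (fun x => x ^+ 3)).
apply: equal_blocks_ge => //.
- exact: u_ge0.
- by rewrite -(sumE id).
- by rewrite -(sumE (fun x => x ^+ 2)) -(edges_antichain anti).
Qed.

Theorem poset_bound (I : finType) (lt : rel I) (u : I -> R) :
  irreflexive lt -> transitive lt -> (forall i, 0 <= u i) -> \sum_i u i <= 1 ->
  p <= edges (cmp lt) u -> cube_blocks k s <= cubic (cmp lt) u u u.
Proof.
move=> lt_irr lt_trans u0 u1 up.
pose v (i : 'I_#|I|) := u (enum_val i).
pose lt' (i j : 'I_#|I|) := lt (enum_val i) (enum_val j).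
have sumE (G : I -> R) : \sum_i G i = \sum_(i < #|I|) G (enum_val i).
  by rewrite (reindex _ (onW_bij _ (enum_val_bij I))).
have cE i j : cmp lt' i j = cmp lt (enum_val i) (enum_val j).
  by rewrite /cmp (inj_eq enum_val_inj).
have eE : edges (cmp lt) u = edges (cmp lt') v.
  rewrite /edges sumE; apply: eq_bigr => i _; rewrite sumE.
  by apply: eq_bigr => j _; rewrite /amx cE.
have -> : cubic (cmp lt) u u u = cubic (cmp lt') v v v.
  rewrite /cubic sumE; apply: eq_bigr => i _; rewrite sumE.
  apply: eq_bigr => j _; rewrite sumE.
  by apply: eq_bigr => l _; rewrite /maj /amx !cE.
apply: poset_bound_ord; last first.
  by split; [move=> i; exact: u0 | rewrite /v -(sumE u) | rewrite -eE].
  by move=> j i l; exact: lt_trans.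
by move=> i; rewrite /lt' lt_irr.
Qed.

End PosetBound.

(** * Weights on a grid *)

Section TripleSum.
Variables (R : realFieldType) (I : finType) (u : I -> R).

Definition triple (G : I -> I -> I -> R) : R :=
  \sum_a \sum_b \sum_c G a b c * u a * u b * u c.

Lemma tripleC12 G : triple G = triple (fun a b c => G b a c).
Proof.
rewrite /triple exchange_big; apply: eq_bigr => a _; apply: eq_bigr => b _.
by apply: eq_bigr => c _; ring.
Qed.

Lemma tripleC23 G : triple G = triple (fun a b c => G a c b).
Proof.
rewrite /triple; apply: eq_bigr => a _; rewrite exchange_big.
by apply: eq_bigr => b _; apply: eq_bigr => c _; ring.
Qed.

Lemma tripleD G H : triple (fun a b c => G a b c + H a b c) = triple G + triple H.
Proof.
rewrite /triple -big_split; apply: eq_bigr => a _ /=.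
rewrite -big_split; apply: eq_bigr => b _ /=.
by rewrite -big_split; apply: eq_bigr => c _ /=; ring.
Qed.

Lemma triple_sum_perms G :
  triple (fun a b c => G a b c + G a c b + G b a c + G b c a + G c a b + G c b a)
  = 6 * triple G.
Proof.
rewrite !tripleD.
have E1 : triple (fun a b c => G a c b) = triple G by rewrite (tripleC23 G).
have E2 : triple (fun a b c => G b a c) = triple G by rewrite (tripleC12 G).
have E3 : triple (fun a b c => G b c a) = triple G.
  by rewrite tripleC12 E1.
have E4 : triple (fun a b c => G c a b) = triple G.
  by rewrite tripleC23 E2.
have E5 : triple (fun a b c => G c b a) = triple G.
  by rewrite tripleC12 E4.
rewrite E1 E2 E3 E4 E5; ring.
Qed.

Lemma triple_prod (f g : I -> I -> R) :
  triple (fun a b c => f a b * g a c)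
  = \sum_a u a * (\sum_b f a b * u b) * (\sum_c g a c * u c).
Proof.
apply: eq_bigr => a _.
rewrite [u a * _]mulr_sumr mulr_suml; apply: eq_bigr => b _.
by rewrite mulr_sumr; apply: eq_bigr => c _; ring.
Qed.

Lemma le_triple G H : (forall a, 0 <= u a) ->
  (forall a b c, G a b c <= H a b c) -> triple G <= triple H.
Proof.
move=> u0 GH; apply: ler_sum => a _; apply: ler_sum => b _; apply: ler_sum => c _.
by rewrite !ler_wpM2r.
Qed.

End TripleSum.

Section Grid.
Variables (R : realType) (M : nat).
Let N := M.+1.
Local Notation cell := ('I_N * 'I_N)%type.
Implicit Types (a b c : cell) (u : cell -> R).

Definition cell_lt a b := (a.1 < b.1)%N && (a.2 < b.2)%N.

Lemma cell_lt_irr : irreflexive cell_lt.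
Proof. by move=> a; rewrite /cell_lt ltnn. Qed.

Lemma cell_lt_trans : transitive cell_lt.
Proof.
move=> b a c /andP[x1 y1] /andP[x2 y2].
by rewrite /cell_lt (ltn_trans x1 x2) (ltn_trans y1 y2).
Qed.

(** [b] is a witness to the left of [a] and [c] one below it. Averaged over both witnesses with
    uniform margins this is the product of the coordinates of [a], so its triple sum is [moment]. *)
Definition quadrant a b c : R := (b.1 < a.1)%N%:R * (c.2 < a.2)%N%:R.

Definition ties a b c : R :=
  (a.1 == b.1)%:R + (a.1 == c.1)%:R + (b.1 == c.1)%:R +
  ((a.2 == b.2)%:R + (a.2 == c.2)%:R + (b.2 == c.2)%:R).

(* For three points with distinct coordinates [ties] vanishes and this is an
   equality: of the six choices of a base point and two witnesses, two are
   quadrant configurations if a majority of the pairs is concordant, and one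
   otherwise. *)
Lemma maj_quadrant a b c :
  maj R (cmp cell_lt) a b c <=
    quadrant a b c + quadrant a c b + quadrant b a c + quadrant b c a
    + quadrant c a b + quadrant c b a - 1 + 2 * ties a b c.
Proof.
have maj1 : maj R (cmp cell_lt) a b c <= 1.
  rewrite /maj /amx.
  by case: cmp; case: cmp; case: cmp => /=; lra.
have q0 x y z : 0 <= quadrant x y z by rewrite mulr_ge0 ?ler0n.
have [t1|t0] := boolP [|| a.1 == b.1, a.1 == c.1, b.1 == c.1,
    a.2 == b.2, a.2 == c.2 | b.2 == c.2].
  have t2 : 1 <= ties a b c.
    rewrite /ties; move: t1.
    by do !case: (_ == _) => //=; lra.
  have := (q0 a b c, q0 a c b, q0 b a c, q0 b c a, q0 c a b, q0 c b a).
  by move=> [[[[[? ?] ?] ?] ?] ?]; lra.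
move: t0 maj1; case: a b c => [a1 a2] [b1 b2] [c1 c2] /=.
rewrite /maj /amx /cmp /quadrant /ties /cell_lt !xpair_eqE /= -!val_eqE /=.
move: (a1 : nat) (a2 : nat) (b1 : nat) (b2 : nat) (c1 : nat) (c2 : nat).
move=> {}a1 {}a2 {}b1 {}b2 {}c1 {}c2 t _.
move: t; rewrite !negb_or => /and5P[ab ac bc ab2 /andP[ac2 bc2]].
rewrite (negbTE ab) (negbTE ac) (negbTE bc) (negbTE ab2) (negbTE ac2) (negbTE bc2) /=.
case: (ltngtP a1 b1) ab => //= H1 _; case: (ltngtP a1 c1) ac => //= H2 _;
case: (ltngtP b1 c1) bc => //= H3 _; try lia;
case: (ltngtP a2 b2) ab2 => //= H4 _; case: (ltngtP a2 c2) ac2 => //= H5 _;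
case: (ltngtP b2 c2) bc2 => //= H6 _; try lia; lra.
Qed.

End Grid.

Section GridMass.
Variables (R : realType) (M : nat).
Let N := M.+1.
Local Notation cell := ('I_N * 'I_N)%type.
Implicit Types (a b c : cell) (u : cell -> R).

Definition uniform_margins u :=
  [/\ forall a, 0 <= u a, forall i, \sum_j u (i, j) = N%:R^-1
    & forall j, \sum_i u (i, j) = N%:R^-1].

Definition concordance u : R := \sum_a u a * \sum_b (cell_lt b a)%:R * u b.
Definition moment u : R :=
  \sum_a u a * ((a.1%:R / N%:R) * (a.2%:R / N%:R)).
Definition flip u a := u (a.1, rev_ord a.2).

Lemma sum_cell (G : cell -> R) : \sum_a G a = \sum_i \sum_j G (i, j).
Proof. by rewrite pair_bigA; apply: eq_bigr => -[]. Qed.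

Lemma sum_cell2 (G : cell -> R) : \sum_a G a = \sum_j \sum_i G (i, j).
Proof. by rewrite sum_cell exchange_big. Qed.

Let N0 : N%:R != 0 :> R. Proof. by rewrite pnatr_eq0. Qed.

Lemma flip_margins u : uniform_margins u -> uniform_margins (flip u).
Proof.
move=> [u0 r c]; split => [a|i|j]; first exact: u0.
  by rewrite -(r i) (reindex_inj rev_ord_inj); apply: eq_bigr => j _;
    rewrite /flip /= rev_ordK.
by rewrite -(c (rev_ord j)).
Qed.

Section Fixed.
Variable u : cell -> R.
Hypothesis um : uniform_margins u.
Let u_ge0 : forall a, 0 <= u a. Proof. by case: um. Qed.

Lemma mass1 : \sum_a u a = 1.
Proof.
rewrite sum_cell; under eq_bigr do rewrite (let: And3 _ r _ := um in r).
by rewrite sumr_const card_ord -[RHS](mulfV N0) mulr_natl.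
Qed.

Lemma mass_row (P : pred 'I_N) :
  \sum_b (P b.1)%:R * u b = (\sum_i (P i)%:R) / N%:R.
Proof.
rewrite sum_cell mulr_suml; apply: eq_bigr => i _ /=.
by rewrite -mulr_sumr (let: And3 _ r _ := um in r).
Qed.

Lemma mass_col (P : pred 'I_N) :
  \sum_b (P b.2)%:R * u b = (\sum_i (P i)%:R) / N%:R.
Proof.
rewrite sum_cell2 mulr_suml; apply: eq_bigr => i _ /=.
by rewrite -mulr_sumr (let: And3 _ _ r := um in r).
Qed.

Lemma count_lt (i : 'I_N) : \sum_(j < N) (j < i)%N%:R = i%:R :> R.
Proof.
rewrite -natr_sum; congr (_%:R).
rewrite -[RHS](card_ord i) -sum1_card (big_ord_widen N (fun=> 1%N)) ?(ltnW (ltn_ord i)) //.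
rewrite [RHS]big_mkcond /=.
by apply: eq_bigr => j _; case: (_ < _)%N.
Qed.

Lemma count_eq (i : 'I_N) : \sum_(j < N) (i == j)%:R = 1 :> R.
Proof.
rewrite (bigD1 i) //= eqxx big1 ?addr0 // => j; rewrite eq_sym => /negbTE -> //.
Qed.

Let triple1 : triple u (fun _ _ _ => 1) = 1.
Proof.
have := triple_prod u (fun _ _ => 1) (fun _ _ => 1).
rewrite mulr1 => ->.
have -> : \sum_b 1 * u b = 1 by under eq_bigr do rewrite mul1r; exact: mass1.
by under eq_bigr do rewrite !mulr1; exact: mass1.
Qed.

Let triple_quadrant : triple u (@quadrant R M) = moment u.
Proof.
rewrite (triple_prod u (fun a b => (b.1 < a.1)%N%:R) (fun a c => (c.2 < a.2)%N%:R)).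
apply: eq_bigr => a _.
rewrite (mass_row (fun i => i < a.1)%N) (mass_col (fun i => i < a.2)%N) !count_lt.
by rewrite -mulrA.
Qed.

Let triple_pair f : triple u (fun a b _ => f a b) = \sum_a u a * \sum_b f a b * u b.
Proof.
apply: eq_bigr => a _; rewrite mulr_sumr; apply: eq_bigr => b _.
by rewrite -mulr_sumr mass1; ring.
Qed.

Let triple_ties : triple u (@ties R M) = 6 / N%:R.
Proof.
have H1 : triple u (fun a b _ => (a.1 == b.1)%:R) = N%:R^-1.
  rewrite triple_pair; under eq_bigr => a _.
    rewrite (mass_row (fun i => a.1 == i)) count_eq mul1r; over.
  by rewrite -mulr_suml mass1 mul1r.
have H2 : triple u (fun a b _ => (a.2 == b.2)%:R) = N%:R^-1.
  rewrite triple_pair; under eq_bigr => a _.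
    rewrite (mass_col (fun i => a.2 == i)) count_eq mul1r; over.
  by rewrite -mulr_suml mass1 mul1r.
have ac f x : triple u (fun a b _ => f a b) = x -> triple u (fun a _ c => f a c) = x.
  by rewrite tripleC23.
have bc f x : triple u (fun a b _ => f a b) = x -> triple u (fun _ b c => f b c) = x.
  by move=> /ac; rewrite tripleC12.
rewrite /ties !tripleD H1 H2 (ac _ _ H1) (ac _ _ H2) (bc _ _ H1) (bc _ _ H2).
ring.
Qed.

(** The six permutations of [quadrant] contribute [6 * moment u]. Each of the six ties has weight
    [1 / N] and enters twice, hence [12 / N]. *)
Lemma cubic_le_moment :
  cubic (cmp (@cell_lt M)) u u u <= 6 * moment u - 1 + 12 / N%:R.
Proof.
pose S a b c : R := quadrant R a b c + quadrant R a c b + quadrant R b a c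
  + quadrant R b c a + quadrant R c a b + quadrant R c b a.
have -> : 6 * moment u - 1 + 12 / N%:R =
    triple u (fun a b c => S a b c - 1 + 2 * ties R a b c).
  have tripleZ k G : triple u (fun a b c => k * G a b c) = k * triple u G.
    rewrite /triple mulr_sumr; apply: eq_bigr => a _; rewrite mulr_sumr.
    apply: eq_bigr => b _; rewrite mulr_sumr; apply: eq_bigr => c _; ring.
  have eS : triple u S = 6 * moment u.
    by rewrite (triple_sum_perms u (@quadrant R M)) triple_quadrant.
  have e1 : triple u (fun _ _ _ => - 1) = - 1.
    have := tripleZ (-1) (fun _ _ _ => 1); rewrite triple1 mulr1 => E.
    rewrite -[RHS]E /triple; do 3 (apply: eq_bigr => ? _); ring.
  rewrite (tripleD u (fun a b c => S a b c - 1)) (tripleD u S) eS e1 tripleZ triple_ties.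
  by rewrite mulrA -natrM.
apply: le_triple => // a b c; exact: maj_quadrant.
Qed.

Lemma concordance_le_edges :
  2 * concordance u <= edges (cmp (@cell_lt M)) u.
Proof.
pose G a b : R := (cell_lt b a)%:R * u a * u b.
have E1 : concordance u = \sum_a \sum_b G a b.
  by apply: eq_bigr => a _; rewrite mulr_sumr; apply: eq_bigr => b _; rewrite /G; ring.
have E2 : concordance u = \sum_a \sum_b G b a by rewrite E1 exchange_big.
rewrite mulrDl mul1r {1}E1 E2 -big_split; apply: ler_sum => a _ /=.
rewrite -big_split; apply: ler_sum => b _ /=; rewrite /G.
have -> : (cell_lt a b)%:R * u b * u a = (cell_lt a b)%:R * u a * u b by ring.
rewrite -!mulrDl !ler_wpM2r // /amx /cmp.
have [->|_] := eqVneq a b; first by rewrite cell_lt_irr /= addr0 ler01.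
case ab: (cell_lt a b); case ba: (cell_lt b a) => //=; rewrite ?addr0 ?add0r //.
by have := cell_lt_trans ab ba; rewrite cell_lt_irr.
Qed.

Lemma concordance_ge0 : 0 <= concordance u.
Proof.
apply: sumr_ge0 => a _; rewrite mulr_ge0 //; apply: sumr_ge0 => b _.
by rewrite mulr_ge0 ?ler0n.
Qed.

Lemma moment_ge : 0 <= 6 * moment u - 1 + 12 / N%:R.
Proof.
apply: le_trans cubic_le_moment; apply: le_trans (cubic_ge_cubes (cmpR _) u_ge0).
by apply: sumr_ge0 => a _; rewrite exprn_ge0.
Qed.

Lemma grid_bound k s : (0 < k)%N -> 0 <= s -> k%:R * s <= 1 ->
  sq_blocks k s <= 2 * concordance u ->
  cube_blocks k s <= 6 * moment u - 1 + 12 / N%:R.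
Proof.
move=> k0 s0 s1 le; apply: le_trans cubic_le_moment.
apply: (poset_bound k0 s0 s1) => //.
- exact: cell_lt_irr.
- exact: cell_lt_trans.
- by rewrite mass1.
- exact: le_trans le concordance_le_edges.
Qed.

(** The second coordinates of a cell and of its mirror image add up to [M / N], so the sum depends
    on the row margin alone; it is [(M / N) ^+ 2 / 2]. *)
Lemma moment_flip : moment u + moment (flip u) <= 2^-1.
Proof.
have rE (G : cell -> R) :
    \sum_a flip u a * G a = \sum_a u a * G (a.1, rev_ord a.2).
  rewrite !sum_cell; apply: eq_bigr => i _.
  rewrite [RHS](reindex_inj rev_ord_inj); apply: eq_bigr => j _ /=.
  by rewrite /flip /= rev_ordK.
rewrite /moment rE -big_split /=.
have -> : \sum_a (u a * (a.1%:R / N%:R * (a.2%:R / N%:R))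
     + u a * (a.1%:R / N%:R * ((N - a.2.+1)%N%:R / N%:R)))
   = \sum_a u a * (a.1%:R * (M%:R / N%:R ^+ 2)).
  apply: eq_bigr => a _.
  have -> : (N - a.2.+1)%N%:R = M%:R - a.2%:R :> R.
    by rewrite subSS natrB // -ltnS ltn_ord.
  by field.
rewrite sum_cell.
have -> : \sum_i \sum_j u (i, j) * ((i, j).1%:R * (M%:R / N%:R ^+ 2))
   = (\sum_(i < N) i%:R) * (N%:R^-1 * (M%:R / N%:R ^+ 2)).
  rewrite mulr_suml; apply: eq_bigr => i _ /=.
  by rewrite -mulr_suml (let: And3 _ r _ := um in r); ring.
have -> : \sum_(i < N) i%:R = N%:R * M%:R / 2 :> R.
  rewrite /N; elim: (M) => [|m IH]; first by rewrite big_ord_recr big_ord0 /= mulr0 mul0r addr0.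
  by rewrite big_ord_recr /= IH -!(natr1 m.+1) -!(natr1 m); field.
have : M%:R / N%:R <= 1 :> R by rewrite ler_pdivrMr ?ltr0n // mul1r ler_nat.
have : 0 <= M%:R / N%:R :> R by rewrite divr_ge0.
move=> x0 x1; suff : 2^-1 * (M%:R / N%:R) ^+ 2 <= 2^-1 :> R.
  by apply: le_trans; rewrite le_eqVlt; apply/orP; left; apply/eqP; field.
move: x0 x1; move: (M%:R / N%:R : R) => x x0 x1; by rewrite ler_piMr ?invr_ge0 // expr_le1.
Qed.

(** Flipping makes discordant pairs concordant; the pairs that are neither share a row or a column,
    and each kind weighs [1 / N]. *)
Lemma concordance_flip :
  1 - 2 / N%:R <= 2 * concordance u + 2 * concordance (flip u).
Proof.
have E2 : concordance (flip u) =
    \sum_a u a * \sum_(b : cell) ((b.1 < a.1)%N && (a.2 < b.2)%N)%:R * u b.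
  rewrite /concordance !sum_cell; apply: eq_bigr => i _.
  rewrite [RHS](reindex_inj rev_ord_inj); apply: eq_bigr => j _.
  rewrite /flip /=; congr (_ * _).
  rewrite !sum_cell; apply: eq_bigr => i' _.
  rewrite [RHS](reindex_inj rev_ord_inj); apply: eq_bigr => j' _ /=.
  congr (_%:R * _); congr nat_of_bool; rewrite /cell_lt /=; congr (_ && _).
  by move: (ltn_ord j) => jN; rewrite ltn_sub2lE.
pose G1 a b : R := (cell_lt b a)%:R.
pose G2 a b : R := ((b.1 < a.1)%N && (a.2 < b.2)%N)%:R.
have sw G : \sum_a u a * \sum_b G a b * u b = \sum_a u a * \sum_b G b a * u b :> R.
  under eq_bigr do rewrite mulr_sumr.
  rewrite exchange_big; apply: eq_bigr => a _.
  by rewrite mulr_sumr; apply: eq_bigr => b _; ring.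
have row : \sum_a u a * \sum_(b : cell) (a.1 == b.1)%:R * u b = N%:R^-1 :> R.
  under eq_bigr => a _.
    rewrite (mass_row (fun i => a.1 == i)) count_eq mul1r; over.
  by rewrite -mulr_suml mass1 mul1r.
have col : \sum_a u a * \sum_(b : cell) (a.2 == b.2)%:R * u b = N%:R^-1 :> R.
  under eq_bigr => a _.
    rewrite (mass_col (fun i => a.2 == i)) count_eq mul1r; over.
  by rewrite -mulr_suml mass1 mul1r.
have one : \sum_a u a * \sum_b 1 * u b = 1 :> R.
  under eq_bigr do under eq_bigr do rewrite mul1r.
  by rewrite -mulr_suml mass1 mul1r.
rewrite lerBlDr.
have -> : 2 * concordance u + 2 * concordance (flip u) + 2 / N%:R
   = \sum_a u a * \sum_b (G1 a b + G1 b a + (G2 a b + G2 b a)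
        + ((a.1 == b.1)%:R + (a.2 == b.2)%:R)) * u b.
  have add G H : \sum_a u a * \sum_b (G a b + H a b) * u b =
      \sum_a u a * \sum_b G a b * u b + \sum_a u a * \sum_b H a b * u b :> R.
    rewrite -big_split; apply: eq_bigr => a _ /=; rewrite -mulrDr -big_split.
    by congr (_ * _); apply: eq_bigr => b _ /=; ring.
  rewrite !add row col -(sw G1) -(sw G2) E2 /concordance -/G1; ring.
rewrite -[leLHS]one; apply: ler_sum => a _; rewrite ler_wpM2l //.
apply: ler_sum => b _; rewrite ler_wpM2r // /G1 /G2 /cell_lt -!val_eqE /=.
case: (ltngtP a.1 b.1) => _; case: (ltngtP a.2 b.2) => _ /=; lra.
Qed.

End Fixed.
End GridMass.

(** * Approximation of the integrals by sums over cells *)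

Section Copula.
Variables (R : realType) (A : R -> R -> R).
Hypothesis cA : is_copula A.

Definition vol (a b c d : R) : R := A b d - A a d - A b c + A a c.

Lemma vol_ge0 a b c d : 0 <= a -> a <= b -> b <= 1 -> 0 <= c -> c <= d -> d <= 1 ->
  0 <= vol a b c d.
Proof. by move=> *; exact: (copula_2increasing cA). Qed.

Lemma copula_mono x1 x2 y1 y2 : 0 <= x1 -> x1 <= x2 -> x2 <= 1 ->
  0 <= y1 -> y1 <= y2 -> y2 <= 1 -> A x1 y1 <= A x2 y2.
Proof.
move=> x10 x12 x21 y10 y12 y21.
have H1 : 0 <= vol x1 x2 0 y1 by apply: vol_ge0; lra.
have H2 : 0 <= vol 0 x2 y1 y2 by apply: vol_ge0; lra.
have e1 : A x1 0 = 0 by apply: (copula_x0 cA); lra.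
have e2 : A x2 0 = 0 by apply: (copula_x0 cA); lra.
have e3 : A 0 y1 = 0 by apply: (copula_0y cA); lra.
have e4 : A 0 y2 = 0 by apply: (copula_0y cA); lra.
by rewrite /vol in H1 H2; lra.
Qed.

Lemma copula_lip x1 x2 y1 y2 : 0 <= x1 -> x1 <= x2 -> x2 <= 1 ->
  0 <= y1 -> y1 <= y2 -> y2 <= 1 -> A x2 y2 <= A x1 y1 + (x2 - x1) + (y2 - y1).
Proof.
move=> x10 x12 x21 y10 y12 y21.
have H1 : 0 <= vol x1 x2 y2 1 by apply: vol_ge0; lra.
have H2 : 0 <= vol x1 1 y1 y2 by apply: vol_ge0; lra.
have e1 : A x1 1 = x1 by apply: (copula_x1 cA); lra.
have e2 : A x2 1 = x2 by apply: (copula_x1 cA); lra.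
have e3 : A 1 y1 = y1 by apply: (copula_1y cA); lra.
have e4 : A 1 y2 = y2 by apply: (copula_1y cA); lra.
by rewrite /vol in H1 H2; lra.
Qed.

Lemma copula_ge0 x y : 0 <= x <= 1 -> 0 <= y <= 1 -> 0 <= A x y.
Proof.
move=> /andP[x0 x1] /andP[y0 y1]; have <- : A 0 0 = 0 by apply: (copula_x0 cA); rewrite lexx ler01.
by apply: copula_mono.
Qed.

Lemma copula_le1 x y : 0 <= x <= 1 -> 0 <= y <= 1 -> A x y <= 1.
Proof.
move=> /andP[x0 x1] /andP[y0 y1].
have -> : 1 = A 1 1 by rewrite (copula_x1 cA) ?ler01 ?lexx.
by apply: copula_mono.
Qed.

Variable mu : probability (R * R)%type R.
Hypothesis muA : induces mu A.

Let mrect (i j : interval R) : measurable ([set` i] `*` [set` j] : set (R * R)).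
Proof. by apply: measurableX; exact: measurable_itv. Qed.

Lemma mu_strip a b y : 0 <= a -> a <= b -> b <= 1 -> 0 <= y <= 1 ->
  mu (`]a, b] `*` `[0, y]) = (A b y - A a y)%:E.
Proof.
move=> a0 ab b1 y01.
have -> : `]a, b] `*` `[0, y] = (`[0, b] `*` `[0, y]) `\` (`[0, a] `*` `[0, y]).
  apply/seteqP; split => -[u v] /=; rewrite !in_itv /=.
    move=> [/andP[au ub] yv]; split; first by split => //; rewrite ub andbT; lra.
    by move=> [/andP[_ ua] _]; lra.
  move=> [[/andP[u0 ub] yv] H]; split=> //; rewrite ub andbT ltNge; apply/negP => ua.
  by apply: H; rewrite u0 ua.
rewrite measureD //; try exact: mrect; last first.
  by rewrite (le_lt_trans (probability_le1 mu _)) ?ltry //; exact: mrect.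
rewrite setIidr; last first.
  move=> -[u v] /=; rewrite !in_itv /= => -[/andP[-> ua] ->]; split => //=; lra.
have E1 : mu (`[0, b] `*` `[0, y]) = (A b y)%:E by apply: muA => //; lra.
have E2 : mu (`[0, a] `*` `[0, y]) = (A a y)%:E by apply: muA => //; lra.
exact: etrans (f_equal2 (fun s t => s - t)%E E1 E2) _.
Qed.

Lemma mu_cell a b c d : 0 <= a -> a <= b -> b <= 1 -> 0 <= c -> c <= d -> d <= 1 ->
  mu (`]a, b] `*` `]c, d]) = (vol a b c d)%:E.
Proof.
move=> a0 ab b1 c0 cd d1.
have -> : `]a, b] `*` `]c, d] = (`]a, b] `*` `[0, d]) `\` (`]a, b] `*` `[0, c]).
  apply/seteqP; split => -[u v] /=; rewrite !in_itv /=.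
    move=> [uab /andP[cv vd]]; split; first by split => //; rewrite vd andbT; lra.
    by move=> [_ /andP[_ vc]]; lra.
  move=> [[uab /andP[v0 vd]] H]; split=> //; rewrite vd andbT ltNge; apply/negP => vc.
  by apply: H; rewrite v0 vc.
rewrite measureD //; try exact: mrect; last first.
  by rewrite (le_lt_trans (probability_le1 mu _)) ?ltry //; exact: mrect.
rewrite setIidr; last first.
  move=> -[u v] /=; rewrite !in_itv /= => -[-> /andP[-> ua]]; split => //=; lra.
have E1 : mu (`]a, b] `*` `[0, d]) = (A b d - A a d)%:E by apply: mu_strip => //; lra.
have E2 : mu (`]a, b] `*` `[0, c]) = (A b c - A a c)%:E by apply: mu_strip => //; lra.
apply: etrans (f_equal2 (fun s t => s - t)%E E1 E2) _.
rewrite -EFinB; congr (_%:E); rewrite /vol; ring.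
Qed.

Lemma mu_square : mu (@unit_square R) = 1%E.
Proof. by rewrite muA ?ler01 ?lexx // (copula_x1 cA) ?ler01 ?lexx. Qed.

Lemma measurable_square : measurable (@unit_square R).
Proof. exact: mrect. Qed.

(** On the unit square, [A] at a point is the [mu]-mass of the section of [B] at that point, and
    such masses depend measurably on the point. *)
Lemma measurable_copula : measurable_fun (@unit_square R) (fun p => A p.1 p.2).
Proof.
pose B := [set q : (R * R) * (R * R) |
  [/\ 0 <= q.2.1 <= q.1.1 & 0 <= q.2.2 <= q.1.2]].
have mB : measurable B.
  have mle (f g : (R * R) * (R * R) -> R) : measurable_fun setT f ->
      measurable_fun setT g -> measurable [set q | f q <= g q].
    move=> mf mg; have := measurable_fun_ler mf mg.
    by move=> /(_ measurableT [set true]) /(_ I); rewrite setTI.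
  have m11 : measurable_fun setT (fun q : (R * R) * (R * R) => q.1.1).
    by apply: measurableT_comp; [exact: measurable_fst | exact: measurable_fst].
  have m12 : measurable_fun setT (fun q : (R * R) * (R * R) => q.1.2).
    by apply: measurableT_comp; [exact: measurable_snd | exact: measurable_fst].
  have m21 : measurable_fun setT (fun q : (R * R) * (R * R) => q.2.1).
    by apply: measurableT_comp; [exact: measurable_fst | exact: measurable_snd].
  have m22 : measurable_fun setT (fun q : (R * R) * (R * R) => q.2.2).
    by apply: measurableT_comp; [exact: measurable_snd | exact: measurable_snd].
  have -> : B = ([set q | 0 <= q.2.1] `&` [set q | q.2.1 <= q.1.1]) `&`
     ([set q : (R * R) * (R * R) | 0 <= q.2.2] `&` [set q | q.2.2 <= q.1.2]).
    apply/seteqP; split => q /=.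
      by move=> [/andP[a b] /andP[c d]].
    by move=> [[a b] [c d]]; split; apply/andP.
  by apply: measurableI; apply: measurableI; apply: mle => //; exact: measurable_cst.
have mx := measurable_fun_xsection mu mB.
have mF : measurable_fun [set: \bar R] (fine : \bar R -> R).
  by apply: fine_measurable.
have mfx := measurableT_comp mF mx.
apply: (@eq_measurable_fun _ _ _ _ _ (fine \o (mu \o xsection B))); last first.
  exact: measurable_funTS mfx.
move=> [x y] /set_mem [] /=; rewrite !in_itv /= => x01 y01.
have -> : xsection B (x, y) = `[0, x] `*` `[0, y].
  apply/seteqP; split => -[u v].
    by rewrite /xsection /= inE => -[a b]; split; rewrite /= in_itv.
  by move=> [] /=; rewrite !in_itv /= => a b; rewrite /xsection /= inE; split.
by rewrite muA.
Qed.

Section Step.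
Variable M : nat.
Let N := M.+1.
Local Notation cell := ('I_N * 'I_N)%type.
Let node (i : nat) : R := i%:R / N%:R.

Let node_ge0 i : 0 <= node i. Proof. by rewrite divr_ge0. Qed.
Let node_le1 (i : 'I_N) : node i.+1 <= 1.
Proof. by rewrite ler_pdivrMr // mul1r ler_nat. Qed.
Let node_le i j : (i <= j)%N -> node i <= node j.
Proof. by move=> ij; rewrite ler_pM2r ?invr_gt0 // ler_nat. Qed.

Definition grid_mass (c : cell) : R :=
  vol (node c.1) (node c.1.+1) (node c.2) (node c.2.+1).
(** Half-open, so that cells are disjoint and [mu] of a cell is a difference of values of [A]. The
    left and lower edges of the square belong to no cell. *)
Let cset (c : cell) : set (R * R) :=
  `]node c.1, node c.1.+1] `*` `]node c.2, node c.2.+1].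

Let mu_cset c : mu (cset c) = (grid_mass c)%:E.
Proof. by apply: mu_cell => //; rewrite ?node_le1 // node_le. Qed.

Let cset_sub c : cset c `<=` @unit_square R.
Proof.
move=> -[x y] [] /=; rewrite !in_itv /= => /andP[a b] /andP[d e].
have := node_ge0 c.1; have := node_ge0 c.2; have := node_le1 c.1.
have := node_le1 c.2; split; rewrite /= in_itv /=; lra.
Qed.

Lemma cset_disjoint c c' p : cset c p -> cset c' p -> c = c'.
Proof.
have key (i j : 'I_N) x : node i < x -> x <= node i.+1 ->
    node j < x -> x <= node j.+1 -> i = j.
  move=> a b d e; apply/val_inj/eqP; rewrite /= eqn_leq.
  have lt k l : node k < node l -> (k < l)%N.
    by rewrite ltr_pM2r ?invr_gt0 // ltr_nat.
  by apply/andP; split; rewrite -ltnS; apply: lt; [exact: lt_le_trans a e | exact: lt_le_trans d b].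
case: c c' p => [i j] [i' j'] [x y] [] /=; rewrite !in_itv /=.
move=> /andP[a b] /andP[d e] [] /=; rewrite !in_itv /= => /andP[a' b'] /andP[d' e'].
by rewrite (key _ _ _ a b a' b') (key _ _ _ d e d' e').
Qed.

Let mcset c : measurable (cset c). Proof. exact: mrect. Qed.

Lemma step_integral (lo : cell -> R) : (forall c, 0 <= lo c) ->
  (\int[mu]_(p in @unit_square R) (\sum_c lo c * \1_(cset c) p)%:E
   = (\sum_c lo c * grid_mass c)%:E)%E.
Proof.
move=> lo0; have mI c : measurable_fun (@unit_square R) (EFin \o (\1_(cset c) : R * R -> R)).
  by apply/measurable_EFinP; exact: measurable_indic.
under eq_integral do rewrite -sumEFin.
under eq_integral do under eq_bigr do rewrite EFinM.
rewrite (ge0_integral_sum mu measurable_square) //; last 2 first.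
- by move=> c; apply: (measurable_funeM (lo c)%:E); exact: mI.
- by move=> c p _; rewrite -EFinM lee_fin mulr_ge0 // indicE ler0n.
rewrite -sumEFin; apply: eq_bigr => c _.
have I0 p : unit_square p -> (0 <= (\1_(cset c) p)%:E :> \bar R)%E.
  by move=> _; rewrite lee_fin indicE ler0n.
rewrite (ge0_integralZl_EFin mu measurable_square I0 (mI c) (lo0 c)).
rewrite (integral_indic mu measurable_square (mcset c)).
rewrite setIidl; last exact: cset_sub.
rewrite EFinM; congr (_ * _)%E; exact: mu_cset.
Qed.

Lemma integral_square_ge (g : R * R -> R) (lo : cell -> R) :
  measurable_fun (@unit_square R) g -> (forall p, unit_square p -> 0 <= g p <= 1) ->
  (forall c, 0 <= lo c) -> (forall c p, cset c p -> lo c <= g p) ->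
  \sum_c lo c * grid_mass c <= \int[mu]_(p in @unit_square R) g p.
Proof.
move=> mg g01 lo0 log; have mD := measurable_square.
have mgE : measurable_fun (@unit_square R) (EFin \o g) by exact/measurable_EFinP.
have le1 : (\int[mu]_(p in @unit_square R) (g p)%:E <= 1)%E.
  have -> : 1%E = (\int[mu]_(p in @unit_square R) (cst 1 p))%E.
    by rewrite integral_cst // mul1e; exact/esym/mu_square.
  apply: ge0_le_integral => //.
  - by move=> p /g01 /andP[? _]; rewrite lee_fin.
  - by move=> p /g01 /andP[_ ?]; rewrite lee_fin.
have ge0 : (0 <= \int[mu]_(p in @unit_square R) (g p)%:E)%E.
  by apply: integral_ge0 => p /g01 /andP[? _]; rewrite lee_fin.
have fin : (\int[mu]_(p in @unit_square R) (g p)%:E)%E \is a fin_num.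
  by rewrite ge0_fin_numE // (le_lt_trans le1) // ltry.
rewrite /Rintegral -[leLHS]/(fine (\sum_c lo c * grid_mass c)%:E) fine_le //.
rewrite -step_integral //; apply: ge0_le_integral => //.
- move=> p _; rewrite lee_fin sumr_ge0 // => c _.
  by rewrite mulr_ge0 // indicE ler0n.
- apply/measurable_EFinP; apply: measurable_sum => c.
  by apply: measurable_funM; [exact: measurable_cst | exact: measurable_indic].
- move=> p Dp; rewrite lee_fin.
  have [[c cp]|none] := pselect (exists c, cset c p).
    rewrite (bigD1 c) //= big1 ?addr0 => [|c' c'c].
      by rewrite indicE mem_set // mulr1; exact: log.
    rewrite indicE memNset ?mulr0 // => c'p; move/eqP: c'c; apply.
    exact: cset_disjoint c'p cp.
  rewrite big1 => [|c _]; first by case/andP: (g01 _ Dp).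
  by rewrite indicE memNset ?mulr0 // => cp; apply: none; exists c.
Qed.

Lemma sum_lt_widen (F : nat -> R) k : (k <= N)%N ->
  \sum_(i < N) (i < k)%N%:R * F i = \sum_(0 <= i < k) F i.
Proof.
move=> kN; rewrite big_mkord (big_ord_widen N F kN) [RHS]big_mkcond /=.
by apply: eq_bigr => i _; case: ifP; rewrite ?mul1r ?mul0r.
Qed.

Lemma sum_vol_col x y k :
  \sum_(0 <= j < k) vol x y (node j) (node j.+1)
  = A y (node k) - A x (node k) - (A y 0 - A x 0).
Proof.
have n0 : node 0 = 0 by rewrite /node mul0r.
rewrite -{2 3}n0 -(telescope_sumr (fun j => A y (node j) - A x (node j))) //.
by apply: eq_bigr => j _; rewrite /vol; ring.
Qed.

Lemma sum_vol_row x y k :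
  \sum_(0 <= i < k) vol (node i) (node i.+1) x y
  = A (node k) y - A (node k) x - (A 0 y - A 0 x).
Proof.
have n0 : node 0 = 0 by rewrite /node mul0r.
rewrite -{2 3}n0 -(telescope_sumr (fun i => A (node i) y - A (node i) x)) //.
by apply: eq_bigr => i _; rewrite /vol; ring.
Qed.

Let nodeN : node N = 1. Proof. by rewrite /node divff ?gt_eqF. Qed.

Let node01 (i : 'I_N) : 0 <= node i <= 1.
Proof. by rewrite node_ge0 /= (le_trans (node_le (leqnSn i))). Qed.
Let nodeS01 (i : 'I_N) : 0 <= node i.+1 <= 1.
Proof. by rewrite node_ge0 node_le1. Qed.
Let zero01 : 0 <= (0 : R) <= 1. Proof. by rewrite lexx ler01. Qed.
Let nodeS (i : nat) : node i.+1 = node i + N%:R^-1.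
Proof. by rewrite /node -(natr1 i) mulrDl mul1r. Qed.

Lemma grid_mass_margins : uniform_margins grid_mass.
Proof.
split.
- by move=> c; apply: vol_ge0; rewrite ?node_le1 // node_le.
- move=> i; rewrite -(big_mkord xpredT (fun j =>
    vol (node i) (node i.+1) (node j) (node j.+1))) sum_vol_col nodeN.
  by rewrite !(copula_x1 cA) // !(copula_x0 cA) // nodeS; ring.
- move=> j; rewrite -(big_mkord xpredT (fun i =>
    vol (node i) (node i.+1) (node j) (node j.+1))) sum_vol_row nodeN.
  by rewrite !(copula_1y cA) // !(copula_0y cA) // nodeS; ring.
Qed.

(** The cells strictly to the left of and below [c] tile the rectangle from the origin to the lower
    left corner of [c], so the inner sum telescopes and the concordance is a lower sum for the
    integral of [A]. *)
Lemma concordance_grid :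
  concordance grid_mass = \sum_(c : cell) A (node c.1) (node c.2) * grid_mass c.
Proof.
apply: eq_bigr => c _; rewrite mulrC; congr (_ * _).
rewrite sum_cell.
have -> : \sum_i \sum_j (cell_lt (i, j) c)%:R * grid_mass (i, j) =
    \sum_(i < N) (i < c.1)%N%:R *
       (\sum_(0 <= j < c.2) vol (node i) (node i.+1) (node j) (node j.+1)).
  apply: eq_bigr => i _.
  rewrite -(sum_lt_widen (fun j => vol (node i) (node i.+1) (node j) (node j.+1)))
    ?(ltnW (ltn_ord _)) //.
  rewrite mulr_sumr; apply: eq_bigr => j _.
  by rewrite mulrA -natrM mulnb.
rewrite (sum_lt_widen (fun i => \sum_(0 <= j < c.2)
   vol (node i) (node i.+1) (node j) (node j.+1))) ?(ltnW (ltn_ord _)) //.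
rewrite exchange_big /=; under eq_bigr do rewrite sum_vol_row.
have n0 : node 0 = 0 by rewrite /node mul0r.
have -> : \sum_(0 <= j < c.2) (A (node c.1) (node j.+1) - A (node c.1) (node j)
   - (A 0 (node j.+1) - A 0 (node j))) =
   \sum_(0 <= j < c.2) vol 0 (node c.1) (node j) (node j.+1).
  by apply: eq_bigr => j _; rewrite /vol; ring.
by rewrite sum_vol_col !(copula_x0 cA) // (copula_0y cA) // subr0 subrr subr0.
Qed.

(** The lower bound for [1 - g]. Since the cells carry total mass 1, the edges missed by them cause
    no loss. *)
Lemma integral_square_le (g : R * R -> R) (hi : cell -> R) :
  measurable_fun (@unit_square R) g -> (forall p, unit_square p -> 0 <= g p <= 1) ->
  (forall c, hi c <= 1) -> (forall c p, cset c p -> g p <= hi c) ->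
  \int[mu]_(p in @unit_square R) g p <= \sum_c hi c * grid_mass c.
Proof.
move=> mg g01 hi1 hig; have mD := measurable_square.
have mg' : measurable_fun (@unit_square R) (fun p => 1 - g p).
  by apply: measurable_funB => //; exact: measurable_cst.
have := @integral_square_ge (fun p => 1 - g p) (fun c => 1 - hi c) mg'.
have h01 p : unit_square p -> 0 <= 1 - g p <= 1 by move=> /g01; lra.
move=> /(_ h01) H.
have {H} := H (fun c => ltac:(rewrite subr_ge0; exact: hi1))
  (fun c p cp => ltac:(rewrite lerD2l lerN2; exact: hig cp)).
have -> : \sum_c (1 - hi c) * grid_mass c = 1 - \sum_c hi c * grid_mass c.
  rewrite -[X in _ = X - _](mass1 grid_mass_margins) -sumrB; apply: eq_bigr => c _; ring.
suff -> : \int[mu]_(p in @unit_square R) (1 - g p) =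
    1 - \int[mu]_(p in @unit_square R) g p by lra.
have bnd (f : R * R -> R) : measurable_fun (@unit_square R) f ->
    (forall p, unit_square p -> 0 <= f p <= 1) ->
    mu.-integrable (@unit_square R) (EFin \o f).
  move=> mf f01; apply: measurable_bounded_integrable => //.
    apply: (@le_lt_trans _ _ 1%E); last exact: ltry.
    by rewrite le_eqVlt; apply/orP; left; exact/eqP/mu_square.
  exists 1; split => // x x1 p /= Dp; rewrite ger0_norm; last by case/andP: (f01 p Dp).
  by apply: (le_trans _ (ltW x1)); case/andP: (f01 p Dp).
rewrite RintegralB //; last by apply: bnd.
  by rewrite Rintegral_cst // mul1r; congr (_ - _); exact: (f_equal fine mu_square).
apply: bnd => [|p _]; first exact: measurable_cst.
by rewrite ler01 lexx.
Qed.

Lemma integral_copula_bounds :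
  concordance grid_mass <= \int[mu]_(p in @unit_square R) A p.1 p.2
    <= concordance grid_mass + 2 / N%:R.
Proof.
have A01 p : @unit_square R p -> 0 <= A p.1 p.2 <= 1.
  move=> [] /=; rewrite !in_itv /= => p1 p2.
  by rewrite copula_ge0 // copula_le1.
have Ac (c : cell) : 0 <= A (node c.1) (node c.2) by apply: copula_ge0.
rewrite concordance_grid; apply/andP; split.
  apply: integral_square_ge => //; first exact: measurable_copula.
  move=> c [x y] [] /=; rewrite !in_itv /= => /andP[x1 x2] /andP[y1 y2].
  have := node_le1 c.1; have := node_le1 c.2.
  by move=> ? ?; apply: copula_mono => //; lra.
have -> : \sum_(c : cell) A (node c.1) (node c.2) * grid_mass c + 2 / N%:R =
    \sum_(c : cell) (A (node c.1) (node c.2) + 2 / N%:R) * grid_mass c.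
  under [RHS]eq_bigr do rewrite mulrDl.
  by rewrite big_split /= -mulr_sumr (mass1 grid_mass_margins) mulr1.
apply: le_trans (integral_square_le (hi := fun c : cell => A (node c.1.+1) (node c.2.+1))
  measurable_copula A01 _ _) _.
- by move=> c; apply: copula_le1.
- move=> c [x y] [] /=; rewrite !in_itv /= => /andP[x1 x2] /andP[y1 y2].
  have := node_ge0 c.1; have := node_ge0 c.2.
  by move=> ? ?; apply: copula_mono => //; lra.
- apply: ler_sum => c _; apply: ler_wpM2r.
    by case: grid_mass_margins.
  apply: le_trans (copula_lip (node_ge0 c.1) (node_le (leqnSn _)) (node_le1 _)
    (node_ge0 c.2) (node_le (leqnSn _)) (node_le1 _)) _.
  by rewrite !nodeS; lra.
Qed.

Lemma integral_prod_bounds :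
  moment grid_mass <= \int[mu]_(p in @unit_square R) (p.1 * p.2)
    <= moment grid_mass + 2 / N%:R.
Proof.
have mg : measurable_fun (@unit_square R) (fun p => p.1 * p.2).
  apply: measurable_funM; apply: measurable_funTS.
    exact: measurable_fst.
  exact: measurable_snd.
have A01 p : @unit_square R p -> 0 <= p.1 * p.2 <= 1.
  move=> [] /=; rewrite !in_itv /= => /andP[a b] /andP[c d].
  by rewrite mulr_ge0 //= mulr_ile1.
have -> : moment grid_mass = \sum_(c : cell) (node c.1 * node c.2) * grid_mass c.
  by apply: eq_bigr => c _; rewrite mulrC.
apply/andP; split.
  apply: integral_square_ge => //; first by move=> c; rewrite mulr_ge0.
  move=> c [x y] [] /=; rewrite !in_itv /= => /andP[x1 x2] /andP[y1 y2].
  by rewrite ler_pM // ltW.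
have -> : \sum_(c : cell) (node c.1 * node c.2) * grid_mass c + 2 / N%:R =
    \sum_(c : cell) ((node c.1 * node c.2) + 2 / N%:R) * grid_mass c.
  under [RHS]eq_bigr do rewrite mulrDl.
  by rewrite big_split /= -mulr_sumr (mass1 grid_mass_margins) mulr1.
apply: le_trans (integral_square_le (hi := fun c : cell => node c.1.+1 * node c.2.+1)
  mg A01 _ _) _.
- by move=> c; rewrite mulr_ile1 // node_le1.
- move=> c [x y] [] /=; rewrite !in_itv /= => /andP[x1 x2] /andP[y1 y2].
  have := node_ge0 c.1; have := node_ge0 c.2.
  by move=> ? ?; apply: ler_pM => //; lra.
- apply: ler_sum => c _; apply: ler_wpM2r.
    by case: grid_mass_margins.
  have := node_le1 c.1; have := node_le1 c.2; have := node_ge0 c.1; have := node_ge0 c.2.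
  rewrite !nodeS; have : 0 < N%:R^-1 :> R by rewrite invr_gt0.
  move: (node c.1) (node c.2) (N%:R^-1) => x y e e0 y0 x0 y1 x1.
  have : 0 <= e * (1 - y - e) by apply: mulr_ge0; lra.
  have : 0 <= e * (1 - x - e) by apply: mulr_ge0; lra.
  have : 0 <= e * e by apply: mulr_ge0; lra.
  lra.
Qed.

End Step.
End Copula.

(** * Existence of the measure induced by a copula *)

Lemma uniform_prob_unit (R : realType) (U : set R) : measurable U ->
  uniform_prob (@ltr01 R) U = lebesgue_measure (U `&` `[0, 1]).
Proof.
move=> mU; have m01 : measurable (U `&` `[0, 1]%classic).
  by apply: measurableI => //; exact: measurable_itv.
rewrite /uniform_prob integral_uniform_pdf (eq_integral (fun=> 1%E)).
  by rewrite integral_cst // mul1e.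
move=> x /set_mem [_ /=]; rewrite in_itv /= => x01.
by rewrite /uniform_pdf x01 subr0 invr1.
Qed.

Section Existence.
Variables (R : realType) (A : R -> R -> R).
Hypothesis cA : is_copula A.
Local Notation vol := (vol A).
Implicit Types (w : seq bool) (t : R).

(* The unit square is bisected repeatedly, alternating between the two
   directions; a word lists the halves that were chosen, the last one first. *)
Fixpoint box w : (R * R) * (R * R) :=
  if w is b :: w' then
    let: ((x0, x1), (y0, y1)) := box w' in
    let xm := (x0 + x1) / 2 in let ym := (y0 + y1) / 2 in
    if odd (size w') then ((x0, x1), if b then (ym, y1) else (y0, ym))
    else (if b then (xm, x1) else (x0, xm), (y0, y1))
  else ((0, 1), (0, 1)).

Definition wmass w := vol (box w).1.1 (box w).1.2 (box w).2.1 (box w).2.2.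

Fixpoint start w : R :=
  if w is b :: w' then start w' + (if b then wmass (false :: w') else 0) else 0.

(** The address of [t]: at each stage the half whose interval contains it. Points outside [[0, 1[]
    get an all-[false] or all-[true] address. *)
Fixpoint word n t : seq bool :=
  if n is n'.+1 then
    let w := word n' t in (start w + wmass (false :: w) <= t) :: w
  else [::].

Lemma box_bounds w : [/\ 0 <= (box w).1.1, (box w).1.1 <= (box w).1.2,
  (box w).1.2 <= 1, 0 <= (box w).2.1 & (box w).2.1 <= (box w).2.2 <= 1].
Proof.
elim: w => [|b w IH] /=; first by split; lra.
move: IH; case: (box w) => -[x0 x1] [y0 y1] /= [a1 a2 a3 a4 /andP[a5 a6]].
by case: ifP => _; case: b => /=; split; lra.
Qed.

Lemma box_width w : (box w).1.2 - (box w).1.1 = 2^-1 ^+ (uphalf (size w)) /\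
  (box w).2.2 - (box w).2.1 = 2^-1 ^+ (size w)./2.
Proof.
elim: w => [|b w]; first by rewrite /= subr0 expr0.
rewrite [size (b :: w)]/= [uphalf (size w).+1]/= [(size w).+1./2]/= uphalf_half.
move=> [] /=; case: (box w) => -[x0 x1] [y0 y1] /=.
case: ifP => o /= e1 e2; rewrite ?add1n ?add0n ?exprS in e1 *.
  by split; [rewrite -e1 | rewrite -e2; case: b => /=; lra].
by split; [rewrite -e1; case: b => /=; lra | rewrite -e2].
Qed.

Lemma wmass_ge0 w : 0 <= wmass w.
Proof.
by have [? ? ? ? /andP[? ?]] := box_bounds w; apply: (vol_ge0 cA).
Qed.

Lemma wmass_split w : wmass (false :: w) + wmass (true :: w) = wmass w.
Proof.
rewrite /wmass /=; case: (box w) => -[x0 x1] [y0 y1] /=.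
by case: ifP => _ /=; rewrite /vol; ring.
Qed.

Lemma wmass_nil : wmass [::] = 1.
Proof.
rewrite /wmass /= /vol (copula_x1 cA) ?(copula_x0 cA) ?(copula_0y cA) ?lexx ?ler01 //.
by ring.
Qed.

Definition witv w : set R := `[start w, start w + wmass w[.

Lemma witv_nil : witv [::] = `[0, 1[%classic.
Proof. by rewrite /witv /= wmass_nil add0r. Qed.

Lemma witv_cons b w t : witv (b :: w) t <->
  witv w t /\ b = (start w + wmass (false :: w) <= t).
Proof.
have := wmass_ge0 (false :: w); have := wmass_ge0 (true :: w).
have := wmass_split w.
case: b; rewrite /witv /= !in_itv /=;
  move: (wmass (false :: w)) (wmass (true :: w)) (wmass w) (start w);
  move=> m0 m1 m s e m1_ge m0_ge.
  split; first by move=> H; split; [lra | apply/esym; lra].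
  by move=> [H1 H2]; move: (esym H2) => {}H2; lra.
split.
  by move=> H; split; [lra | apply/esym/negbTE; rewrite -ltNge; lra].
by move=> [H1 H2]; move/esym/negbT: H2; rewrite -ltNge; lra.
Qed.

Lemma word_witv w t : witv w t -> word (size w) t = w.
Proof. by elim: w => //= b w IH /witv_cons[/IH -> ->]. Qed.

Lemma measurable_word n (g : seq bool -> R) :
  measurable_fun [set: R] (fun t => g (word n t)).
Proof.
elim: n g => [|n IH] g; first exact: (@measurable_cst _ _ _ _ setT (g [::])).
rewrite [X in measurable_fun _ X](_ : _ = (fun t =>
    if start (word n t) + wmass (false :: word n t) <= t
    then g (true :: word n t) else g (false :: word n t))); last first.
  by apply/funext => t /=; case: ifP.
apply: measurable_fun_ifT.
- apply: measurable_fun_ler; last exact: measurable_id.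
  exact: (IH (fun w => start w + wmass (false :: w))).
- exact: (IH (fun w => g (true :: w))).
- exact: (IH (fun w => g (false :: w))).
Qed.

Lemma measurable_word_pred n (P : pred (seq bool)) : measurable [set t : R | P (word n t)].
Proof.
have := measurable_word n (fun w => (P w)%:R).
move=> /(_ measurableT _ (@measurable_set1 R 1)); rewrite setTI.
rewrite [X in measurable X -> _](_ : _ = [set t | P (word n t)]) //.
apply/seteqP; split => t /=; last by move=> ->.
by case: (P _) => // /eqP; rewrite eq_sym oner_eq0.
Qed.

Fixpoint word_sum n (g : seq bool -> R) w : R :=
  if n is n'.+1 then word_sum n' g (false :: w) + word_sum n' g (true :: w)
  else g w.

Lemma le_word_sum n g h w : (forall v, size v = (size w + n)%N -> g v <= h v) ->
  word_sum n g w <= word_sum n h w.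
Proof.
elim: n w => [|n IH] w gh /=; first by apply: gh; rewrite addn0.
by apply: lerD; apply: IH => v sv; apply: gh; rewrite sv /= addSnnS.
Qed.

(** The points of [witv w] with a given longer address form the interval of that address, whose
    length is by construction the volume of its box. *)
Lemma word_prob n (P : pred (seq bool)) w :
  lebesgue_measure (witv w `&` [set t : R | P (word (size w + n) t)]) =
  (word_sum n (fun v => (P v)%:R * wmass v) w)%:E.
Proof.
elim: n w => [|n IH] w /=.
  rewrite addn0; have [Pw|nPw] := boolP (P w).
    rewrite setIidl; last by move=> t /word_witv /= ->.
    rewrite /witv lebesgue_measure_itv /= lte_fin mul1r.
    have := wmass_ge0 w; rewrite le_eqVlt => /orP[/eqP <-|w0].
      by rewrite addr0 ltxx.
    by rewrite ltrDl w0 -EFinB; congr (_%:E); ring.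
  rewrite mul0r (_ : _ `&` _ = set0) ?measure0 //.
  by apply/seteqP; split => t // -[/word_witv /= ->]; rewrite (negbTE nPw).
have -> : witv w `&` [set t | P (word (size w + n.+1) t)] =
    (witv (false :: w) `&` [set t | P (word (size (false :: w) + n) t)]) `|`
    (witv (true :: w) `&` [set t | P (word (size (true :: w) + n) t)]).
  rewrite addnS ![size (_ :: _)]/= !addSn; apply/seteqP; split => t.
    move=> [wt Pt]; case E: (start w + wmass (false :: w) <= t).
      by right; split => //; apply: (proj2 (witv_cons _ _ _)); rewrite E.
    by left; split => //; apply: (proj2 (witv_cons _ _ _)); rewrite E.
  by move=> [[/witv_cons[wt _] Pt]|[/witv_cons[wt _] Pt]].
rewrite measureU; last first.
- apply/seteqP; split => t // -[[/witv_cons[_ e1] _] [/witv_cons[_ e2] _]].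
  by rewrite -e1 in e2.
- by apply: measurableI; [exact: measurable_itv | exact: measurable_word_pred].
- by apply: measurableI; [exact: measurable_itv | exact: measurable_word_pred].
exact: etrans (f_equal2 (fun r s => r + s)%E (IH (false :: w)) (IH (true :: w))) _.
Qed.

Lemma box_cons b w :
  [/\ (box w).1.1 <= (box (b :: w)).1.1, (box (b :: w)).1.2 <= (box w).1.2,
      (box w).2.1 <= (box (b :: w)).2.1 & (box (b :: w)).2.2 <= (box w).2.2].
Proof.
move: (box_bounds w) => /=; case: (box w) => -[x0 x1] [y0 y1] /=.
by move=> [a1 a2 a3 a4 /andP[a5 a6]]; case: ifP => _; case: b; split => /=; lra.
Qed.

(** The volume of the part of the box to the left of [x] and below [y]; if that part is empty,
    truncation collapses a side and the volume is 0. *)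
Definition cut x y w : R :=
  vol (Num.min (box w).1.1 x) (Num.min (box w).1.2 x)
      (Num.min (box w).2.1 y) (Num.min (box w).2.2 y).

Lemma word_sum_cut n x y w : word_sum n (cut x y) w = cut x y w.
Proof.
elim: n w => //= n IH w; rewrite !IH /cut /=.
case: (box w) => -[x0 x1] [y0 y1] /=.
by case: ifP => _ /=; rewrite /vol; ring.
Qed.

Lemma cut_nil x y : 0 <= x <= 1 -> 0 <= y <= 1 -> cut x y [::] = A x y.
Proof.
move=> /andP[x0 x1] /andP[y0 y1].
rewrite /cut /= (min_l x0) (min_l y0) (min_r x1) (min_r y1) /vol.
rewrite (copula_x0 cA) ?x0 // !(copula_0y cA) ?y0 ?lexx ?ler01 //; ring.
Qed.

Lemma cut_ge0 x y w : 0 <= x -> 0 <= y -> 0 <= cut x y w.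
Proof.
move=> x0 y0; have [a1 a2 a3 a4 /andP[a5 a6]] := box_bounds w.
apply: (vol_ge0 cA); rewrite ?le_min ?ge_min ?a1 ?a3 ?a4 ?a6 ?x0 ?y0 //.
  by rewrite a2 lexx orbT.
by rewrite a5 lexx orbT.
Qed.

Lemma cut_le_wmass x y w : 0 <= x -> 0 <= y -> cut x y w <= wmass w.
Proof.
move=> x0 y0; have [a1 a2 a3 a4 /andP[a5 a6]] := box_bounds w.
rewrite /cut; have := wmass_ge0 w; rewrite /wmass.
move: (box w) a1 a2 a3 a4 a5 a6 => [[a b] [c d]] /= a0 ab b1 c0 cd d1 m0.
have [xa|] := boolP (x <= a); last rewrite -ltNge => /ltW ax.
  rewrite [Num.min a x]min_r // [Num.min b x]min_r ?(le_trans xa) // /vol.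
  by move: m0; rewrite /vol; lra.
have [yc|] := boolP (y <= c); last rewrite -ltNge => /ltW cy.
  rewrite [Num.min c y]min_r // [Num.min d y]min_r ?(le_trans yc) // /vol.
  by move: m0; rewrite /vol; lra.
rewrite (min_l ax) (min_l cy).
have h1 : a <= Num.min b x by rewrite le_min ab ax.
have h2 : Num.min b x <= b by rewrite ge_min lexx.
have h3 : c <= Num.min d y by rewrite le_min cd cy.
have h4 : Num.min d y <= d by rewrite ge_min lexx.
move: (Num.min b x) (Num.min d y) h1 h2 h3 h4 => b' d' h1 h2 h3 h4.
have H1 : 0 <= vol b' b c d' by apply: (vol_ge0 cA); lra.
have H2 : 0 <= vol a b d' d by apply: (vol_ge0 cA); lra.
by move: H1 H2; rewrite /vol; lra.
Qed.

(** At depth [n.*2] both sides of a box are [e]. A box that exceeds [x] or [y] lies entirely beyond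
    [x - e] or [y - e], so it contributes nothing to [A (x - e) (y - e)], and this value is within
    [2 * e] of [A x y]. *)
Lemma word_sum_below n x y : 0 <= x <= 1 -> 0 <= y <= 1 ->
  A x y - 2 * 2^-1 ^+ n <= word_sum n.*2
    (fun v => (((box v).1.2 <= x) && ((box v).2.2 <= y))%:R * wmass v) [::].
Proof.
move=> x01 y01; set e := 2^-1 ^+ n.
have e0 : 0 < e :> R by rewrite exprn_gt0 ?invr_gt0.
have pos : 0 <= word_sum n.*2
    (fun v => (((box v).1.2 <= x) && ((box v).2.2 <= y))%:R * wmass v) [::].
  have : word_sum n.*2 (fun=> 0) [::] <= word_sum n.*2
    (fun v => (((box v).1.2 <= x) && ((box v).2.2 <= y))%:R * wmass v) [::].
    by apply: le_word_sum => v _; rewrite mulr_ge0 ?wmass_ge0.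
  have z m w : word_sum m (fun=> 0) w = 0 by elim: m w => //= m IH w; rewrite !IH addr0.
  by rewrite z.
have z01 : 0 <= (0 : R) <= 1 by rewrite lexx ler01.
have [xe|ex] := leP x e.
  apply: le_trans pos; have := @copula_lip _ _ cA 0 x y y.
  by rewrite (copula_0y cA) //; lra.
have [ye|ey] := leP y e.
  apply: le_trans pos; have := @copula_lip _ _ cA x x 0 y.
  by rewrite (copula_x0 cA) //; lra.
apply: (@le_trans _ _ (A (x - e) (y - e))).
  have := @copula_lip _ _ cA (x - e) x (y - e) y; lra.
rewrite -(cut_nil (x := x - e) (y := y - e)); try lra.
rewrite -(word_sum_cut n.*2); apply: le_word_sum => v; rewrite add0n => sv.
have [] := box_width v; rewrite sv uphalf_double doubleK -/e => wx wy.
case Hc: (_ && _); first by rewrite mul1r cut_le_wmass //; lra.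
move: Hc => /negbT; rewrite negb_and -!ltNge mul0r /cut => H.
have [a1 a2 a3 a4 /andP[a5 a6]] := box_bounds v.
case/orP: H => H.
  rewrite [Num.min _ (x - e)]min_r; last by lra.
  rewrite [Num.min (box v).1.2 (x - e)]min_r /vol; last by lra.
  by lra.
rewrite [Num.min (box v).2.1 (y - e)]min_r; last by lra.
rewrite [Num.min (box v).2.2 (y - e)]min_r /vol; last by lra.
by lra.
Qed.

Lemma word_sum_above n x y : 0 <= x <= 1 -> 0 <= y <= 1 ->
  word_sum n.*2 (fun v => (((box v).1.1 <= x) && ((box v).2.1 <= y))%:R * wmass v) [::]
  <= A x y + 2 * 2^-1 ^+ n.
Proof.
move=> x01 y01; set e := 2^-1 ^+ n.
have e0 : 0 < e :> R by rewrite exprn_gt0 ?invr_gt0.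
(* Capped at 1 because [A] is constrained on the unit square only. *)
pose x' := Num.min (x + e) 1; pose y' := Num.min (y + e) 1.
have x'e : x' <= x + e by rewrite ge_min lexx.
have y'e : y' <= y + e by rewrite ge_min lexx.
have xx' : x <= x' by rewrite le_min; apply/andP; split; lra.
have yy' : y <= y' by rewrite le_min; apply/andP; split; lra.
have x'1 : x' <= 1 by rewrite ge_min lexx orbT.
have y'1 : y' <= 1 by rewrite ge_min lexx orbT.
apply: (@le_trans _ _ (A x' y')); last first.
  have := @copula_lip _ _ cA x x' y y'; lra.
rewrite -(cut_nil (x := x') (y := y')); try lra.
rewrite -(word_sum_cut n.*2); apply: le_word_sum => v; rewrite add0n => sv.
have [] := box_width v; rewrite sv uphalf_double doubleK -/e => wx wy.
case Hc: (_ && _); last by rewrite mul0r cut_ge0 //; lra.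
move: Hc => /andP[H1 H2].
have [a1 a2 a3 a4 /andP[a5 a6]] := box_bounds v.
have b1 : (box v).1.2 <= x' by rewrite le_min; apply/andP; split; lra.
have b2 : (box v).2.2 <= y' by rewrite le_min; apply/andP; split; lra.
rewrite mul1r /cut (min_l b1) (min_l b2) (min_l (le_trans a2 b1)).
by rewrite (min_l (le_trans a5 b2)).
Qed.

Let limit_bounds (lo hi : nat -> R -> R) :
  (forall n, measurable_fun [set: R] (lo n)) ->
  (forall n t, lo n t <= lo n.+1 t) -> (forall n t, hi n.+1 t <= hi n t) ->
  (forall n t, 0 <= lo n t <= hi n t /\ hi n t <= 1) ->
  exists2 X : R -> R, measurable_fun [set: R] X &
    forall n t, lo n t <= X t <= hi n t.
Proof.
move=> mlo lo_up hi_down lo_hi.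
have lo_nd t : nondecreasing_seq (fun n => lo n t).
  by apply/nondecreasing_seqP => n; exact: lo_up.
have hi_ni t : nonincreasing_seq (fun n => hi n t).
  by apply/nonincreasing_seqP => n; exact: hi_down.
have cv t : cvgn (fun n => lo n t).
  apply: nondecreasing_is_cvgn => //; exists 1 => _ [n _ <-].
  by have [/andP[_ ?] ?] := lo_hi n t; lra.
exists (fun t => limn (fun n => lo n t)).
  apply: (measurable_fun_cvg mlo) => t _; exact: cv.
move=> n t; apply/andP; split; first exact: (nondecreasing_cvgn_le (lo_nd t)).
apply: limr_le => //; apply: nearW => m.
have [/andP[_ H] _] := lo_hi (maxn m n) t.
have := lo_nd t _ _ (leq_maxl m n); have := hi_ni t _ _ (leq_maxr m n).
by move=> /= H1 H2; lra.
Qed.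

Theorem induced_measure_exists : exists mu : probability (R * R)%type R, induces mu A.
Proof.
have bw n t := box_bounds (word n t).
have [X mX Xb] : exists2 X : R -> R, measurable_fun [set: R] X &
    forall n t, (box (word n t)).1.1 <= X t <= (box (word n t)).1.2.
  apply: limit_bounds => [n|n t|n t|n t].
  - exact: (measurable_word n (fun w => (box w).1.1)).
  - by have [] := box_cons (start (word n t) + wmass (false :: word n t) <= t) (word n t).
  - by have [] := box_cons (start (word n t) + wmass (false :: word n t) <= t) (word n t).
  - by have [a1 a2 a3 _ _] := bw n t; rewrite a1 a2.
have [Y mY Yb] : exists2 Y : R -> R, measurable_fun [set: R] Y &
    forall n t, (box (word n t)).2.1 <= Y t <= (box (word n t)).2.2.
  apply: limit_bounds => [n|n t|n t|n t].
  - exact: (measurable_word n (fun w => (box w).2.1)).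
  - by have [] := box_cons (start (word n t) + wmass (false :: word n t) <= t) (word n t).
  - by have [] := box_cons (start (word n t) + wmass (false :: word n t) <= t) (word n t).
  - by have [_ _ _ a1 /andP[a2 a3]] := bw n t; rewrite a1 a2.
have mT : measurable_fun [set: R] (fun t => (X t, Y t)) by exact: measurable_fun_pair.
have mT' : @measurable_fun _ _ (measurableTypeR R) (R * R)%type setT (fun t => (X t, Y t)).
  by exact: mT.
pose T : {mfun (measurableTypeR R) >-> (R * R)%type} :=
  @mfun_Sub _ _ (measurableTypeR R) (R * R)%type (fun t => (X t, Y t)) (mem_set mT').
exists (distribution (uniform_prob (@ltr01 R)) T) => x y x01 y01.
pose U := [set t | 0 <= X t <= x /\ 0 <= Y t <= y].
have mU : measurable U.
  have := mT measurableT _ (measurableX (@measurable_itv R `[0, x]) (@measurable_itv R `[0, y])).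
  by rewrite setTI [X in measurable X -> _](_ : _ = U) //;
    apply/seteqP; split => t; rewrite /U /= !in_itv.
pose V : set R := U `&` `[0, 1]%classic.
apply: (@etrans _ _ (lebesgue_measure V)).
  rewrite -uniform_prob_unit // /distribution /pushforward; congr (uniform_prob _ _).
have m01 : measurable V.
  by apply: measurableI => //; exact: measurable_itv.
have Xge t : 0 <= X t.
  by have := Xb 0%N t; rewrite /= => /andP[].
have Yge t : 0 <= Y t.
  by have := Yb 0%N t; rewrite /= => /andP[].
have mW n (P : pred (seq bool)) : measurable (witv [::] `&` [set t : R | P (word n t)]).
  by apply: measurableI; [exact: measurable_itv | exact: measurable_word_pred].
have below n : ((A x y - 2 * 2^-1 ^+ n)%:E <= lebesgue_measure V)%E.
  apply: le_trans (_ : (_ <= (word_sum n.*2 (fun v => (((box v).1.2 <= x) &&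
    ((box v).2.2 <= y))%:R * wmass v) [::])%:E)%E) _.
    by rewrite lee_fin; exact: word_sum_below.
  rewrite -(word_prob n.*2 (fun v => ((box v).1.2 <= x) && ((box v).2.2 <= y))).
  apply: le_measure; rewrite ?inE //.
    exact: (mW n.*2 (fun v => ((box v).1.2 <= x) && ((box v).2.2 <= y))).
  move=> t [t01 /= /andP[bx by_]]; split; last first.
    by move: t01; rewrite witv_nil /= !in_itv /= => /andP[-> /ltW].
  have := Xb n.*2 t; have := Yb n.*2 t; rewrite /U /= Xge Yge /= => /andP[_ H1] /andP[_ H2].
  by split; [exact: le_trans H2 bx | exact: le_trans H1 by_].
have above n : (lebesgue_measure V <= (A x y + 2 * 2^-1 ^+ n)%:E)%E.
  apply: le_trans (_ : (_ <= (word_sum n.*2 (fun v => (((box v).1.1 <= x) &&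
    ((box v).2.1 <= y))%:R * wmass v) [::])%:E)%E) _; last first.
    by rewrite lee_fin; exact: word_sum_above.
  rewrite -(word_prob n.*2 (fun v => ((box v).1.1 <= x) && ((box v).2.1 <= y))).
  (* [V] may contain the point 1, which lies outside [witv [::]]; it is accounted for as a null
     set. *)
  rewrite -[leRHS]adde0 -(lebesgue_measure_set1 1).
  have mP := mW n.*2 (fun v => ((box v).1.1 <= x) && ((box v).2.1 <= y)).
  apply: le_trans (measureU2 _ _ _); [|exact: mP|exact: measurable_set1].
  apply: le_measure; rewrite ?inE //.
    by apply: measurableU; [exact: mP | exact: measurable_set1].
  move=> t [[/andP[_ Xx] /andP[_ Yy]]]; rewrite /= in_itv /= => /andP[t0].
  rewrite le_eqVlt => /orP[/eqP ->|t1]; first by right.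
  left; split; first by rewrite witv_nil /= in_itv /= t0 t1.
  have := Xb n.*2 t; have := Yb n.*2 t => /andP[H1 _] /andP[H2 _].
  by apply/andP; split; [exact: le_trans H2 Xx | exact: le_trans H1 Yy].
have fin : lebesgue_measure V \is a fin_num.
  rewrite ge0_fin_numE; last exact: measure_ge0.
  exact: le_lt_trans (above 0%N) (ltry _).
rewrite -(fineK fin); congr (_%:E).
have small (z : R) : (forall n, z <= 2 * 2^-1 ^+ n) -> z <= 0.
  move=> H; rewrite leNgt; apply/negP => z0.
  have c0 : 2 * 2^-1 ^+ n @[n --> \oo] --> (0 : R).
    rewrite -[X in _ --> X](mulr0 2); apply: cvgMr; apply: cvg_expr.
    by rewrite ger0_norm ?invr_ge0 // invf_lt1 // ltr1n.
  have := cvgr_lt _ c0 _ z0 => -[n _ /(_ n (leqnn n))] /=.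
  by rewrite ltNge H.
apply: le_anti; apply/andP; split; rewrite -subr_le0; apply: small => n.
  have := above n; rewrite -{1}(fineK fin) lee_fin; lra.
have := below n; rewrite -{1}(fineK fin) lee_fin; lra.
Qed.

End Existence.

(** * Passage to the limit *)

Lemma concordance_le1 (R : realType) M (u : 'I_M.+1 * 'I_M.+1 -> R) :
  uniform_margins u -> 2 * concordance u <= 1.
Proof.
move=> um; have u0 : forall a, 0 <= u a by case: um.
apply: le_trans (concordance_le_edges um) _.
rewrite /edges -[leRHS](mul1r 1) -{1}(mass1 um) -(mass1 um) mulr_suml.
apply: ler_sum => a _; rewrite mulr_sumr; apply: ler_sum => b _.
rewrite -mulrA ler_piMl ?mulr_ge0 // /amx.
by rewrite lern1 leq_b1.
Qed.

(** * Points above the graph of [Phi] *)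

Section Curve.
Variable R : realType.
Implicit Types (x y p s f : R) (k : nat).

Lemma le_grid_limit x y (c e : R) : 0 <= c -> 0 < e ->
  (forall M h, h = M.+1%:R^-1 -> 0 < h -> h <= e -> x <= y + c * h) -> x <= y.
Proof.
move=> c0 e0 H; rewrite leNgt; apply/negP => yx.
have c1 : 0 < c + 1 by lra.
have d0 : 0 < Num.min e ((x - y) / (c + 1)).
  by rewrite lt_min e0 divr_gt0 ?subr_gt0.
have [M] := ltr_add_invr d0; rewrite add0r lt_min => /andP[Me].
have h0 : 0 < M.+1%:R^-1 :> R by rewrite invr_gt0.
rewrite ltr_pdivlMr ?c1 //; move: (H M _ erefl h0 (ltW Me)).
by move: (M.+1%:R^-1 : R) h0 => h h0 h1 h2; lra.
Qed.

(** Strict in [p] because the grid sums reach [p] only in the limit; continuity in [s] later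
    recovers the points with equality. *)
Definition above_curve p f := forall k s, (0 < k)%N -> 0 <= s -> k%:R * s <= 1 ->
  sq_blocks k s < p -> cube_blocks k s <= f.

Lemma above_curve_closed p f k s : above_curve p f -> (0 < k)%N -> 0 < s ->
  k%:R * s <= 1 -> sq_blocks k s = p -> cube_blocks k s <= f.
Proof.
(* The parameter [s] is approached through [s * (1 - h)]. The constant is the rate of change of
   [3 * k * s ^+ 2] along this; the term in [s ^+ 3] has the favourable sign. *)
move=> H k0 s0 ks sp; apply: (@le_grid_limit _ _ (6 * k%:R * s ^+ 2) 1).
- by rewrite !mulr_ge0 ?exprn_ge0 // ltW.
- exact: ltr01.
move=> _ h _ h0 h1.
have k1 : 1 <= k%:R :> R by rewrite ler1n.
have kp : 1 <= k.+1%:R :> R by rewrite ler1n.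
have k0' : 0 < k.+1%:R :> R by rewrite ltr0n.
have s'0 : 0 <= s * (1 - h) by rewrite mulr_ge0 ?subr_ge0 // ltW.
have s's : s * (1 - h) < s by rewrite gtr_pMr // gtrBl.
have : cube_blocks k (s * (1 - h)) <= f.
  apply: H => //; first by apply: le_trans ks; rewrite ler_wpM2l // ltW.
  rewrite -sp /sq_blocks ltr_pM2r ?invr_gt0 // ltrD2l ltr_pM2l ?ltr0n //.
  by rewrite ltr_pXn2r // nnegrE ?ltW.
suff : cube_blocks k s <= cube_blocks k (s * (1 - h)) + 6 * k%:R * s ^+ 2 * h.
  by move=> ? ?; lra.
rewrite /cube_blocks -lerBlDl -mulrBl ler_pdivrMr ?exprn_gt0 //.
apply: (@le_trans _ _ (6 * k%:R * s ^+ 2 * h)).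
  have e3 : 0 <= k%:R * (k%:R - 1) * (s ^+ 3 - (s * (1 - h)) ^+ 3).
    rewrite !mulr_ge0 ?subr_ge0 ?(ltW k1) //.
    by rewrite ler_pXn2r // ?nnegrE ltW.
  have e2 : 0 <= 3 * (k%:R * s ^+ 2) * h ^+ 2.
    by rewrite !mulr_ge0 ?exprn_ge0 // ltW.
  by nra.
rewrite ler_peMr ?exprn_ege1 //.
by rewrite !mulr_ge0 ?exprn_ge0 // ltW.
Qed.

(** For [n = k.+1] the base of the power is [2 * k * s ^+ 2], the square of [w * v * s], so the
    exponent [3 / 2] yields a cube and the radicals cancel. *)
Lemma Phi_n_blocks k s : (0 < k)%N -> 0 <= s ->
  Phi_n k.+1 (2 * sq_blocks k s - 1) = 2 * cube_blocks k s - 1.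
Proof.
move=> k0 s0; rewrite /Phi_n /sq_blocks /cube_blocks.
have n0 : k.+1%:R != 0 :> R by rewrite pnatr_eq0.
have kE : k%:R = k.+1%:R - 1 :> R by rewrite -natr1 addrK.
rewrite -kE; set w := Num.sqrt 2; set v := Num.sqrt k%:R.
have w2 : w ^+ 2 = 2 by rewrite sqr_sqrtr.
have v2 : v ^+ 2 = k%:R by rewrite sqr_sqrtr.
have w0 : 0 < w by rewrite sqrtr_gt0.
have v0 : 0 < v by rewrite sqrtr_gt0 ltr0n.
have -> : k.+1%:R - 2 + k.+1%:R * (2 * ((1 + k%:R * s ^+ 2) / k.+1%:R) - 1)
    = (w * v * s) ^+ 2 by rewrite !exprMn w2 v2; field.
have -> : ((w * v * s) ^+ 2) `^ (3 / 2) = (w * v * s) ^+ 3.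
  have b0 : 0 <= w * v * s by rewrite !mulr_ge0 // ltW.
  rewrite (mulrC 3) powRrM powR12_sqrt ?sqr_ge0 // sqrtr_sqr ger0_norm //.
  by rewrite -[3]/(3%:R) powR_mulrn.
have -> : (w * v * s) ^+ 3 = w * v * (2 * k%:R * s ^+ 3).
  by rewrite -w2 -v2; ring.
have w0' := lt0r_neq0 w0; have v0' := lt0r_neq0 v0.
have -> : (k.+1%:R - 2) / (w * k.+1%:R ^+ 2 * v) * (w * v * (2 * k%:R * s ^+ 3))
   = (k.+1%:R - 2) * (2 * k%:R * s ^+ 3) / k.+1%:R ^+ 2.
  by field; apply/and3P; split => //; rewrite ?w0' ?v0'.
by rewrite kE; field.
Qed.

(** The piece of index [n] is given by [n - 1 <= 2 / (1 + x) <= n], so one more than the integer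
    part of the quotient serves. *)
Lemma Phi_piece_exists x : -1 < x -> x <= 1 -> exists n, Phi_piece x n.
Proof.
move=> x0 x1; have q1 : 1 <= 2 / (1 + x) by rewrite ler_pdivlMr; lra.
have x1' : 0 < 1 + x by lra.
have /andP[] := truncn_itv (le_trans ler01 q1).
have : (0 < Num.truncn (2 / (1 + x)))%N by rewrite truncn_gt0.
move: (Num.truncn _) => m m0; rewrite ler_pdivlMr // ltr_pdivrMr // => h1 h2.
have m1 : 0 < m%:R :> R by rewrite ltr0n.
exists m.+1; split => //; rewrite -!natr1 in h2 *; rewrite addrK.
by rewrite ler_pdivrMr ?ler_pdivlMr; try lra; apply/andP; split; lra.
Qed.

Lemma Phi_le x f : -1 <= x <= 1 -> 0 <= f -> above_curve ((1 + x) / 2) f ->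
  Phi x <= 2 * f - 1.
Proof.
move=> /andP[x0 x1] f0 H; rewrite /Phi; case: eqP => [_|/eqP xN1]; first by lra.
have {}x0 : -1 < x by rewrite lt_neqAle eq_sym xN1.
have [] := getPex (Phi_piece_exists x0 x1).
move: (get _) => [//|k]; rewrite ltnS => k0.
have kE : k%:R = k.+1%:R - 1 :> R by rewrite -natr1 addrK.
have k1 : 0 < k%:R :> R by rewrite ltr0n.
rewrite -kE ler_pdivrMr ?ltr0n // ler_pdivlMr // => /andP[h1 h2].
set p := (1 + x) / 2 in H.
have xE : x = 2 * p - 1 by rewrite /p; field.
(* Solves [sq_blocks k s = p]. The left end of the piece makes the radicand non-negative, the right
   end gives [k * s <= 1]. *)
pose s := Num.sqrt ((k.+1%:R * p - 1) / k%:R).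
have n0 : k.+1%:R != 0 :> R by rewrite pnatr_eq0.
have s0 : 0 <= s by exact: sqrtr_ge0.
have s2 : s ^+ 2 = (k.+1%:R * p - 1) / k%:R.
  by rewrite sqr_sqrtr // divr_ge0 ?(ltW k1) //; nra.
have sqE : sq_blocks k s = p.
  by rewrite /sq_blocks s2; field; rewrite nat1r n0 lt0r_neq0.
have ks : k%:R * s <= 1.
  have H2 : (k%:R * s) ^+ 2 <= 1 ^+ 2.
    rewrite exprMn s2.
    have -> : k%:R ^+ 2 * ((k.+1%:R * p - 1) / k%:R) = k%:R * (k.+1%:R * p - 1).
      by field; rewrite lt0r_neq0.
    rewrite kE in k1 h2 *; nra.
  by rewrite -(@ler_pXn2r _ 2) // nnegrE ?ler01 // mulr_ge0 // ltW.
rewrite xE -sqE Phi_n_blocks //; suff : cube_blocks k s <= f by lra.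
move: s0; rewrite le_eqVlt => /orP[/eqP s0|s0]; last exact: (above_curve_closed H).
(* At [s = 0] there is nothing to approach from below; this point of the curve
   is also the end [s = 1 / k.+1] of the next arc. *)
have -> : cube_blocks k s = cube_blocks k.+1 k.+1%:R^-1.
  rewrite -s0 /cube_blocks -(natr1 k.+1) kE; field.
  by apply/andP; split; apply: lt0r_neq0; lra.
apply: (above_curve_closed H) => //; rewrite ?invr_gt0 ?ltr0n ?mulfV //.
rewrite -sqE -s0 /sq_blocks -(natr1 k.+1); field.
by apply/andP; split; apply: lt0r_neq0; lra.
Qed.

End Curve.

(** * The bounds for one copula *)

Section Region.
Variables (R : realType) (A : R -> R -> R).
Hypothesis cA : is_copula A.
Variables (mu : probability (R * R)%type R) (I E : R).
Hypothesis muA : induces mu A.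
Hypothesis IE : I = \int[mu]_(p in @unit_square R) A p.1 p.2.
Hypothesis EE : E = \int[mu]_(p in @unit_square R) (p.1 * p.2).

Local Notation P := (2 * I).

(** [P'] is twice the concordance of the cell masses, [E'] their moment and [E''] the moment of the
    flipped masses. The error [4 * h] is twice that of the integral [I]. *)
Let grid M (h : R) : h = M.+1%:R^-1 -> exists P' E' E'' : R,
  [/\ P' <= P <= P' + 4 * h, E' <= E <= E' + 2 * h, E' + E'' <= 2^-1,
    0 <= P' <= 1 &
  [/\ 0 <= 6 * E' - 1 + 12 * h, 0 <= 6 * E'' - 1 + 12 * h,
    (forall k s, (0 < k)%N -> 0 <= s -> k%:R * s <= 1 ->
      sq_blocks k s <= P' -> cube_blocks k s <= 6 * E' - 1 + 12 * h) &
    (forall k s, (0 < k)%N -> 0 <= s -> k%:R * s <= 1 ->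
      sq_blocks k s <= 1 - P' - 2 * h -> cube_blocks k s <= 6 * E'' - 1 + 12 * h)]].
Proof.
have um := grid_mass_margins cA M; have rm := flip_margins um.
have cr := concordance_flip um => hE; rewrite -hE in cr.
exists (2 * concordance (grid_mass A (M := M))), (moment (grid_mass A (M := M))).
exists (moment (flip (grid_mass A (M := M)))); split.
- have : concordance (grid_mass A (M := M)) <= I <=
      concordance (grid_mass A (M := M)) + 2 * h.
    by rewrite IE hE; have := integral_copula_bounds cA muA M.
  by move=> /andP[h1 h2]; apply/andP; split; lra.
- by rewrite EE hE; have := integral_prod_bounds cA muA M.
- exact: moment_flip.
- by rewrite mulr_ge0 ?concordance_ge0 //=; exact: concordance_le1.
split; [rewrite hE; exact: moment_ge | rewrite hE; exact: moment_ge | |].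
  by move=> k s k0 s0 ks le; rewrite hE; exact: (grid_bound um).
move=> k s k0 s0 ks le; rewrite hE; apply: (grid_bound rm) => //; lra.
Qed.

Lemma concordance_bounds : 0 <= P <= 1.
Proof.
apply/andP; split; apply: (@le_grid_limit _ _ _ 4 1) => // M h hE h0 _;
  have [P' [E' [E'' [/andP[? ?] _ _ /andP[? ?] _]]]] := grid hE; lra.
Qed.

Lemma moment_bounds : 0 <= 6 * E - 1 <= 1.
Proof.
apply/andP; split; apply: (@le_grid_limit _ _ _ 24 1) => // M h hE h0 _;
  have [P' [E' [E'' [_ /andP[? ?] ? _ [? ? _ _]]]]] := grid hE; lra.
Qed.

Lemma above_curve_copula : above_curve P (6 * E - 1).
Proof.
move=> k s k0 s0 ks lt; apply: (@le_grid_limit _ _ _ 12 ((P - sq_blocks k s) / 4)) => //.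
  by rewrite divr_gt0 ?subr_gt0.
move=> M h hE h0 h_small.
have [P' [E' [E'' [/andP[? ?] /andP[? ?] _ _ [_ _ H _]]]]] := grid hE.
have : cube_blocks k s <= 6 * E' - 1 + 12 * h by apply: H => //; lra.
lra.
Qed.

(** Reflection, carried out on the cell masses, replaces [p] by [1 - p] and [f = 6 * E - 1] by
    [1 - f]. The constant 24 adds the 12 of the grid bound to the 12 from [E <= E' + 2 * h]. *)
Lemma above_curve_flip : above_curve (1 - P) (2 - 6 * E).
Proof.
move=> k s k0 s0 ks lt; apply: (@le_grid_limit _ _ _ 24 ((1 - P - sq_blocks k s) / 2)) => //.
  by rewrite divr_gt0 ?subr_gt0.
move=> M h hE h0 h_small.
have [P' [E' [E'' [/andP[? ?] /andP[? ?] ? _ [_ _ _ H]]]]] := grid hE.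
have : cube_blocks k s <= 6 * E'' - 1 + 12 * h by apply: H => //; lra.
lra.
Qed.

End Region.

Theorem theorem3p6 (R : realType) : @Omega R `<=` @Omega_Phi R.
Proof.
move=> _ [A cA <-].
have muA : induces (copula_measure A) A by exact: getPex (induced_measure_exists cA).
set t := kendall_tau A; set r := spearman_rho A.
pose I := (1 + t) / 4; pose E := (r + 3) / 12.
have IE : I = \int[copula_measure A]_(p in @unit_square R) A p.1 p.2.
  by rewrite /I /t /kendall_tau; field.
have EE : E = \int[copula_measure A]_(p in @unit_square R) (p.1 * p.2).
  by rewrite /E /r /spearman_rho; field.
have := concordance_bounds cA muA IE EE; have := moment_bounds cA muA IE EE.
have := above_curve_copula cA muA IE EE; have := above_curve_flip cA muA IE EE.
have -> : t = 2 * (2 * I) - 1 by rewrite /I; field.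
have -> : r = 2 * (6 * E - 1) - 1 by rewrite /E; field.
move: (2 * I) E {IE EE} => P E up low /andP[E0 E1] /andP[P0 P1].
split => /=; [by apply/andP; split; lra | by apply/andP; split; lra |].
have lo : Phi (2 * P - 1) <= 2 * (6 * E - 1) - 1.
  apply: Phi_le => //; first by apply/andP; split; lra.
  by rewrite (_ : (1 + (2 * P - 1)) / 2 = P) //; field.
have hi : Phi (- (2 * P - 1)) <= 2 * (2 - 6 * E) - 1.
  apply: Phi_le; [by apply/andP; split; lra | lra |].
  by rewrite (_ : (1 - (2 * P - 1)) / 2 = 1 - P) //; field.
by apply/andP; split => //; lra.
Qed.
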